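(* Let $(\boldsymbol\theta_0,\boldsymbol\pi_0)\in\Xi$ and let $X_1,X_2,\dots$ be i.i.d. with density $f(\cdot;(\boldsymbol\theta_0,\boldsymbol\pi_0))$ w.r.t. $[dX]$. Let $\Pi$ be the prior on $\Xi$ described below and $\Pi(\cdot\mid X_1,\dots,X_N)$ the corresponding posterior. Then for every weak neighborhood $\mathcal U$ of $(\boldsymbol\theta_0,\boldsymbol\pi_0)$, $$\Pi(\mathcal U^c\mid X_1,\dots,X_N)\to0\quad\text{almost surely under }F_{\boldsymbol\theta_0,\boldsymbol\pi_0}^\infty\text{ as }N\to\infty.$$
   Context: $\mathcal V_{n,p}=\{X\in\mathbb R^{n\times p}:X^TX=I_p\}$ ($n\ge p$) with normalized Haar probability measure $[dX]$; $\widetilde{\mathcal V}_{n,p}=\{X\in\mathcal V_{n,p}:X_{1j}>0\ \forall j\}$; $\mathcal S_p=\{(d_1,\dots,d_p):0<d_p<\cdots<d_1\}$; ${}_0F_1\!\left(\tfrac n2,\tfrac{D^2}{4}\right)=\int_{\mathcal V_{n,p}}\exp\big(\sum_j d_jX_{jj}\big)[dX]$, $D=\mathrm{diag}(\boldsymbol d)$. $f_{ML}(X;(M,\boldsymbol d,V))=\mathrm{etr}(VDM^TX)/{}_0F_1(\tfrac n2,\tfrac{D^2}4)$. $\boldsymbol\Theta=\widetilde{\mathcal V}_{n,p}^C\times\mathcal S_p^C\times\mathcal V_{p,p}^C$, $\mathbb S_\pi=\{\boldsymbol\pi\in(0,1)^C:\sum_c\pi_c=1\}$, $\Xi=\boldsymbol\Theta\times\mathbb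 S_\pi$, $f(X;(\boldsymbol\theta,\boldsymbol\pi))=\sum_{c=1}^C\pi_cf_{ML}(X;\theta_c)$; $F_{\boldsymbol\theta_0,\boldsymbol\pi_0}$ is the distribution with density $f(\cdot;(\boldsymbol\theta_0,\boldsymbol\pi_0))$ and $F^\infty$ the infinite product measure. Prior $\Pi$: independently across components, $M_c$ has density $\propto\mathrm{etr}(G_c^TM_c)$ (matrix Langevin) on $\widetilde{\mathcal V}_{n,p}$, $V_c$ has density $\propto\mathrm{etr}(H_c^TV_c)$ on $\mathcal V_{p,p}$, $\boldsymbol d_c$ has Lebesgue density on $\mathcal S_p$ proportional to $\exp(\nu_c\boldsymbol\eta_c^T\boldsymbol d_c)/[{}_0F_1(\tfrac n2,\tfrac{D_c^2}4)]^{\nu_c}$ with $\nu_c>0$, $\max_j\eta_{cj}<1$, and $\boldsymbol\pi\sim\mathrm{Dirichlet}(\alpha_1,\dots,\alpha_C)$ with $\alpha_c>0$ (fixed hyperparameters $G_c\in\mathbb R^{n\times p}$, $H_c\in\mathbb R^{p\times p}$). Posterior: $\Pi(A\mid X_{1:N})=\int_A R_N\,d\Pi/\int_\Xi R_N\,d\Pi$ with $R_N(\boldsymbol\theta,\boldsymbol\pi)=\prod_{i=1}^N f(X_i;(\boldsymbol\theta,\boldsymbol\pi))/f(X_i;(\boldsymbol\theta_0,\boldsymbol\pi_0))$. A weak neighborhood of $(\boldsymbol\theta_0,\boldsymbol\pi_0)$ is any subset of $\Xi$ containing a set of the form $\{(\boldsymbol\theta,\boldsymbol\pi):|\int g_i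 f(\cdot;(\boldsymbol\theta_0,\boldsymbol\pi_0))[dX]-\int g_if(\cdot;(\boldsymbol\theta,\boldsymbol\pi))[dX]|<\epsilon,\ i=1,\dots,k\}$ with $\epsilon>0$ and $g_1,\dots,g_k$ bounded continuous functions on $\mathcal V_{n,p}$. *)

(* Defs.v *)
From HB Require Import structures.
From mathcomp Require Import all_boot all_order all_algebra.
From mathcomp Require Import all_classical all_reals all_analysis.
Unset Printing Implicit Defensive.
Import Order.TTheory GRing.Theory Num.Theory.
Import numFieldNormedType.Exports.
Local Open Scope classical_set_scope.
Local Open Scope ring_scope.

Section MatrixLangevinMixture.
Variable R : realType.

Definition mxB (n p : nat) := g_sigma_algebraType (@open ('M[R]_(n, p) : topologicalType)).

Definition Stiefel (n p : nat) : set 'M[R]_(n, p) := [set X | X^T *m X = 1%:M].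

Definition StiefelTilde (n p : nat) : set 'M[R]_(n, p) :=
  [set X | Stiefel n p X /\ forall (i : 'I_n) (j : 'I_p), (i : nat) = 0%N -> 0 < X i j].

Definition Sp (p : nat) (d : nat -> R) : Prop :=
  (forall j, (j < p)%N -> 0 < d j) /\ (forall j, (j.+1 < p)%N -> d j.+1 < d j).

Definition diagp (p : nat) (d : nat -> R) : 'M[R]_p :=
  \matrix_(i < p, j < p) (if i == j then d i else 0).

Definition etr (m : nat) (A : 'M[R]_m) : R := expR (\tr A).
Arguments etr {m}.

(* [dX]: the normalized Haar (O(n)-invariant) probability measure on V_{n,p}.
   Being supported on V_{n,p} and invariant under left multiplication by
   orthogonal matrices characterizes it uniquely. *)
Definition is_haar_stiefel (n p : nat) (mu : probability (mxB n p) R) : Prop :=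
  mu (Stiefel n p : set (mxB n p)) = 1%E /\
  forall Q : 'M[R]_n, Q^T *m Q = 1%:M ->
    forall A : set (mxB n p), measurable A ->
      mu ((fun X : mxB n p => (Q *m X : mxB n p)) @^-1` A) = mu A.

(* 0F1(n/2, D^2/4) = \int_{V_{n,p}} exp(sum_j d_j X_jj) [dX] *)
Definition F01 (n p : nat) (mu : probability (mxB n p) R) (d : nat -> R) : R :=
  Rintegral mu (Stiefel n p : set (mxB n p))
    (fun X : mxB n p => expR (\sum_(i < n) \sum_(j < p) ((i : nat) == j)%:R * d j * X i j)).

Definition fML (n p : nat) (mu : probability (mxB n p) R)
    (M : 'M[R]_(n, p)) (d : nat -> R) (V : 'M[R]_p) (X : 'M[R]_(n, p)) : R :=
  etr (V *m diagp p d *m M^T *m X) / F01 n p mu d.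

(* a parameter (theta, pi): components c = 0 .. C-1 are used *)
Record param (n p : nat) := Param {
  pM : nat -> 'M[R]_(n, p);
  pd : nat -> nat -> R;
  pV : nat -> 'M[R]_p;
  ppi : nat -> R }.
Arguments pM {n p}.
Arguments pd {n p}.
Arguments pV {n p}.
Arguments ppi {n p}.

Definition fmix (n p C : nat) (mu : probability (mxB n p) R) (th : param n p)
    (X : 'M[R]_(n, p)) : R :=
  \sum_(c < C) ppi th c * fML n p mu (pM th c) (pd th c) (pV th c) X.

Definition inXi (n p C : nat) (th : param n p) : Prop :=
  (forall c, (c < C)%N ->
     StiefelTilde n p (pM th c) /\ Sp p (pd th c) /\ Stiefel p p (pV th c)) /\
  (forall c, (c < C)%N -> 0 < ppi th c) /\ \sum_(c < C) ppi th c = 1.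

Definition weak_nbhd (n p C : nat) (mu : probability (mxB n p) R)
    (th0 : param n p) (U : set (param n p)) : Prop :=
  exists (eps : R) (k : nat) (g : nat -> 'M[R]_(n, p) -> R),
    0 < eps /\
    (forall i, (i < k)%N ->
       (exists B : R, forall X, Stiefel n p X -> `|g i X| <= B) /\
       {within Stiefel n p, continuous (g i)}) /\
    [set th | inXi n p C th /\
       forall i, (i < k)%N ->
         `| Rintegral mu (Stiefel n p : set (mxB n p)) (fun X : mxB n p => g i X * fmix n p C mu th0 X)
          - Rintegral mu (Stiefel n p : set (mxB n p)) (fun X : mxB n p => g i X * fmix n p C mu th X) | < eps]
    `<=` U.

Definition upd (T : Type) (y : nat -> T) (k : nat) (t : T) : nat -> T :=
  fun j => if j == k then t else y j.
Arguments upd {T}.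

(* iterI I k F x0 = I_{k-1}(t_{k-1} |-> ... I_0(t_0 |-> F(x0 with coords
   0..k-1 replaced by t_0..t_{k-1})) ...): iterated (product) integration *)
Fixpoint iterI (T : Type) (I : nat -> (T -> \bar R) -> \bar R) (k : nat)
    (F : (nat -> T) -> \bar R) (x0 : nat -> T) : \bar R :=
  match k with
  | 0 => F x0
  | k'.+1 => I k' (fun t => iterI T I k' (fun y => F (upd y k' t)) x0)
  end.
Arguments iterI {T}.

Definition lebInt (k : nat) (F : (nat -> R) -> \bar R) : \bar R :=
  iterI (fun _ (g : R -> \bar R) => (\int[@lebesgue_measure R]_(t in setT) g t)%E)
        k F (fun _ => 0).

Definition densM (n p : nat) (mu : probability (mxB n p) R) (G : 'M[R]_(n, p))
    (X : 'M[R]_(n, p)) : R :=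
  etr (G^T *m X) /
  Rintegral mu (StiefelTilde n p : set (mxB n p)) (fun Y : mxB n p => etr (G^T *m Y)).

Definition densV (p : nat) (mu : probability (mxB p p) R) (H : 'M[R]_p)
    (X : 'M[R]_p) : R :=
  etr (H^T *m X) /
  Rintegral mu (Stiefel p p : set (mxB p p)) (fun Y : mxB p p => etr (H^T *m Y)).

Definition undensd (n p : nat) (mu : probability (mxB n p) R) (nu : R) (eta : nat -> R)
    (d : nat -> R) : R :=
  if `[< Sp p d >] then
    expR (nu * \sum_(j < p) eta j * d j) / (F01 n p mu d `^ nu)
  else 0.

Definition densd (n p : nat) (mu : probability (mxB n p) R) (nu : R) (eta : nat -> R)
    (d : nat -> R) : R :=
  undensd n p mu nu eta d / fine (lebInt p (fun x => (undensd n p mu nu eta x)%:E)).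

(* Dirichlet(alpha_0..alpha_{C-1}) on the open simplex, via its density
   w.r.t. Lebesgue measure in the first C-1 coordinates *)
Definition simplex_ext (C : nat) (w : nat -> R) : nat -> R :=
  fun j => if (j < C.-1)%N then w j
           else if j == C.-1 then 1 - \sum_(k < C.-1) w k else 0.

Definition undensDir (C : nat) (alpha : nat -> R) (w : nat -> R) : R :=
  if `[< forall c, (c < C)%N -> 0 < simplex_ext C w c >] then
    \prod_(c < C) (simplex_ext C w c `^ (alpha c - 1))
  else 0.

Definition dirInt (C : nat) (alpha : nat -> R) (Psi : (nat -> R) -> \bar R) : \bar R :=
  lebInt C.-1 (fun w => (Psi (simplex_ext C w) *
     (undensDir C alpha w / fine (lebInt C.-1 (fun v => (undensDir C alpha v)%:E)))%:E)%E).

(* integral of Phi w.r.t. the prior Pi on Xi: independent M_c, d_c, V_c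
   (c < C) and pi, with the densities above *)
Definition priorInt (n p C : nat) (mun : probability (mxB n p) R)
    (mup : probability (mxB p p) R)
    (G : nat -> 'M[R]_(n, p)) (H : nat -> 'M[R]_p) (nu : nat -> R)
    (eta : nat -> nat -> R) (alpha : nat -> R) (Phi : param n p -> \bar R) : \bar R :=
  iterI (fun c (g : 'M[R]_(n, p) -> \bar R) =>
           (\int[mun]_(X in (StiefelTilde n p : set (mxB n p))) (g X * (densM n p mun (G c) X)%:E))%E)
   C (fun M =>
  iterI (fun c (g : (nat -> R) -> \bar R) =>
           lebInt p (fun x => (g x * (densd n p mun (nu c) (eta c) x)%:E)%E))
   C (fun d =>
  iterI (fun c (g : 'M[R]_p -> \bar R) =>
           (\int[mup]_(Y in (Stiefel p p : set (mxB p p))) (g Y * (densV p mup (H c) Y)%:E))%E)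
   C (fun V =>
  dirInt C alpha (fun w => Phi (Param n p M d V w)))
   (fun _ => 0)) (fun _ _ => 0)) (fun _ => 0).

Definition RN (n p C : nat) (mu : probability (mxB n p) R) (th0 th : param n p)
    (x : nat -> 'M[R]_(n, p)) (N : nat) : R :=
  \prod_(i < N) (fmix n p C mu th (x i) / fmix n p C mu th0 (x i)).

Definition posterior (n p C : nat) (mun : probability (mxB n p) R)
    (mup : probability (mxB p p) R)
    (G : nat -> 'M[R]_(n, p)) (H : nat -> 'M[R]_p) (nu : nat -> R)
    (eta : nat -> nat -> R) (alpha : nat -> R) (th0 : param n p)
    (A : set (param n p)) (x : nat -> 'M[R]_(n, p)) (N : nat) : R :=
  fine (priorInt n p C mun mup G H nu eta alpha
          (fun th => (if `[< A th >] then RN n p C mun th0 th x N else 0)%:E)) /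
  fine (priorInt n p C mun mup G H nu eta alpha (fun th => (RN n p C mun th0 th x N)%:E)).

Definition mutually_independent (d : measure_display) (Omega : measurableType d)
    (n p : nat) (P : probability Omega R) (X : nat -> Omega -> mxB n p) : Prop :=
  forall (s : seq nat) (A : nat -> set (mxB n p)),
    uniq s -> (forall i, measurable (A i)) ->
    P [set w | forall i, i \in s -> A i (X i w)] =
    (\big[*%E/1%E]_(i <- s) P (X i @^-1` A i))%E.

End MatrixLangevinMixture.

(* Main.v *)
(* Schwartz's theorem. Every density of the mixture family integrates to 1 against Haar measure:
   averaging etr(D Y^T X V) over two independent frames X and Y and transposing shows that the mean
   of etr(V D M^T X) depends on D only.
   Denominator of the posterior: parameters in a product box around the truth satisfy
   f_theta >= e^-delta f_0 uniformly on the compact Stiefel manifold, and the box has positive prior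
   mass (Haar measure charges every ball around a frame), so the denominator is at least
   m e^(-delta N).
   Numerator: the complement of a weak neighbourhood is covered by finitely many half-spaces
   {int g f_theta >= int g f_0 + eps}. Centring g between the two means, u = g - int g f_0 - eps/2,
   the exponential weight prod_i exp(-l u(X_i)) tilts both the likelihood over a half-space and,
   with the opposite sign, the true density to mass rho < 1. Tonelli, Markov and Borel-Cantelli then
   make the numerator smaller than sigma^N eventually, for every sigma > rho. *)
Require Import Defs.
From HB Require Import structures.
From mathcomp Require Import all_boot all_order all_algebra.
From mathcomp Require Import all_classical all_reals all_analysis.
From mathcomp Require Import finmap measurable_realfun.
From mathcomp Require Import ring lra.
Import Order.TTheory GRing.Theory Num.Theory.
Import numFieldNormedType.Exports.
Set Implicit Arguments.
Unset Strict Implicit.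
Local Open Scope classical_set_scope.
Local Open Scope ring_scope.

(** * Monotone functionals and iterated integrals *)

Arguments upd {T} y k t _.
Arguments iterI {R T} I k F x0.
Arguments pM {R n p} _ _.
Arguments pd {R n p} _ _ _.
Arguments pV {R n p} _ _.
Arguments ppi {R n p} _ _.

(** The prior does not come as a measure: it is a nest of integrals over types without a
    sigma-algebra, applied to arbitrary functions, and the neighbourhood [U] may be non-measurable.
    Two interfaces deal with this. [pfun] records what holds for all functions nonnegative on the
    support: monotonicity and a lower bound on a box. [repr] turns the functional, on functions
    measurable in the coordinates, into an integral against a sigma-finite measure, as Tonelli
    requires. Both are carried through the nest one integral at a time. The indicator of the
    complement of [U] is only ever bounded above, by a sum over measurable half-spaces. Haar measure
    is known through its left invariance, whereas the frame [V] acts on the right, in tr(D M^T X V);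
    this is why the normalization needs a double average. The closeness of densities being uniform
    on the manifold, the likelihood ratio is bounded below for every sample there, which takes the
    place of a Kullback-Leibler neighbourhood and the law of large numbers. *)

Section Functionals.
Local Open Scope ereal_scope.
Import HBNNSimple.
Variable R : realType.

(** The integral of a nonnegative function is a supremum over the simple functions below it, hence
    monotone even on non-measurable functions. Inner integrals of the nest and indicators of
    arbitrary sets of parameters are of this kind. *)
Lemma le_integral_nonneg d (T : measurableType d) (mu : {measure set T -> \bar R})
    (D : set T) (f g : T -> \bar R) :
  (forall x, D x -> 0 <= f x) -> (forall x, D x -> f x <= g x) ->
  \int[mu]_(x in D) f x <= \int[mu]_(x in D) g x.
Proof.
move=> f0 fg; have g0 x : D x -> 0 <= g x by move=> Dx; rewrite (le_trans (f0 _ Dx)) ?fg.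
rewrite !ge0_integralE//; apply: ereal_sup_le => _ [h hf <-].
exists h => // x; apply: le_trans (hf x) _.
by rewrite !patchE; case: ifPn => // /set_mem; exact: fg.
Qed.

Definition bind (T1 T2 : Type) (J1 : (T1 -> \bar R) -> \bar R)
  (J2 : (T2 -> \bar R) -> \bar R) (F : T1 * T2 -> \bar R) : \bar R :=
  J1 (fun a => J2 (fun b => F (a, b))).

Definition null_functional (T : Type) (J : (T -> \bar R) -> \bar R) := forall f, J f = 0.

(** Stands for [B] having mass at least [m], in a form that needs neither [f] nor the indicator of
    [B] to be measurable. *)
Definition lower_bounded_on (T : Type) (P B : T -> Prop) (J : (T -> \bar R) -> \bar R) :=
  exists2 m : R, (0 < m)%R & forall f (c : R), (0 <= c)%R ->
    (forall t, P t -> 0 <= f t) -> (forall t, P t -> B t -> c%:E <= f t) ->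
    (c * m)%:E <= J f.

(* The alternative [null_functional J] is what a density with a junk normalizing constant
   (0 or [+oo], inverted to 0) leads to. *)
Record pfun (T : Type) (P B : T -> Prop) (J : (T -> \bar R) -> \bar R) : Prop := {
  pfun_ge0 : forall f, (forall t, P t -> 0 <= f t) -> 0 <= J f ;
  pfun_le : forall f g, (forall t, P t -> 0 <= f t) -> (forall t, P t -> f t <= g t) ->
     J f <= J g ;
  pfun0 : J (fun=> 0) = 0 ;
  pfun_lb : null_functional J \/ lower_bounded_on P B J }.

Lemma bind_pfun (T1 T2 : Type) P1 B1 P2 B2 (J1 : (T1 -> \bar R) -> \bar R)
    (J2 : (T2 -> \bar R) -> \bar R) :
  pfun P1 B1 J1 -> pfun P2 B2 J2 ->
  pfun (fun p => P1 p.1 /\ P2 p.2) (fun p => B1 p.1 /\ B2 p.2) (bind J1 J2).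
Proof.
move=> H1 H2; split.
- move=> f f0; apply: (pfun_ge0 H1) => a Pa; apply: (pfun_ge0 H2) => b Pb; exact: f0.
- move=> f g f0 fg; apply: (pfun_le H1) => a Pa.
    by apply: (pfun_ge0 H2) => b Pb; exact: f0.
  by apply: (pfun_le H2) => b Pb; [exact: f0|exact: fg].
- by rewrite /bind (_ : (fun=> _) = (fun=> 0)) ?(pfun0 H1)//; apply/funext => a; exact: (pfun0 H2).
- case: (pfun_lb H1) => [n1|[m1 m10 l1]]; first by left=> f; exact: n1.
  case: (pfun_lb H2) => [n2|[m2 m20 l2]].
    left=> f; rewrite /bind (_ : (fun=> _) = (fun=> 0)) ?(pfun0 H1)//.
    by apply/funext => a; exact: n2.
  right; exists (m2 * m1)%R; first exact: mulr_gt0.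
  move=> f c c0 f0 fc; rewrite mulrA; apply: l1; first by rewrite mulr_ge0// ltW.
    by move=> a Pa; apply: (pfun_ge0 H2) => b Pb; exact: f0.
  by move=> a Pa Ba; apply: l2 => // [b Pb|b Pb Bb]; [exact: f0|exact: fc].
Qed.

Lemma push_pfun (T T' : Type) (m : T -> T') P B P' B' (J : (T -> \bar R) -> \bar R) :
  pfun P B J -> (forall t, P t -> P' (m t)) -> (forall t, P t -> B t -> B' (m t)) ->
  pfun P' B' (fun F => J (F \o m)).
Proof.
move=> H PP BB; split.
- by move=> f f0; apply: (pfun_ge0 H) => t Pt; exact/f0/PP.
- by move=> f g f0 fg; apply: (pfun_le H) => t Pt; [exact/f0/PP|exact/fg/PP].
- exact: (pfun0 H).
- case: (pfun_lb H) => [n|[c c0 l]]; first by left=> f; exact: n.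
  right; exists c => // f e e0 f0 fe; apply: l => // t Pt; first exact/f0/PP.
  by move=> Bt; apply: fe; [exact: PP|exact: BB].
Qed.

(** A density vanishing outside [P] makes the values of the integrand there irrelevant, so the
    support shrinks from the whole type to [P]. On [B] a density at least [k] multiplies the lower
    bound by [k]. *)
Lemma weight_pfun (T : Type) (v : T -> R) (P B : T -> Prop) (J : (T -> \bar R) -> \bar R) :
  pfun (fun=> True) B J -> (forall t, 0 <= v t)%R -> (forall t, v t != 0%R -> P t) ->
  (forall t, B t -> P t) ->
  (forall t, v t = 0%R) \/ (exists2 k : R, (0 < k)%R & forall t, B t -> (k <= v t)%R) ->
  pfun P B (fun F => J (fun t => F t * (v t)%:E)).
Proof.
move=> H v0 vP BP vB.
have ge0 f : (forall t, P t -> 0 <= f t) -> forall t, 0 <= f t * (v t)%:E.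
  move=> f0 t; have [->|/vP Pt] := eqVneq (v t) 0%R; first by rewrite mule0.
  by rewrite mule_ge0 ?lee_fin ?v0 ?f0.
split.
- by move=> f f0; apply: (pfun_ge0 H) => t _; exact: ge0.
- move=> f g f0 fg; apply: (pfun_le H) => t _; first exact: ge0.
  have [->|/vP Pt] := eqVneq (v t) 0%R; first by rewrite !mule0.
  by rewrite lee_wpmul2r ?lee_fin ?v0 ?fg.
- by rewrite (_ : (fun=> _) = (fun=> 0)) ?(pfun0 H)//; apply/funext => t; rewrite mul0e.
- case: vB => [v00|[k k0 kv]].
    left=> f; rewrite (_ : (fun=> _) = (fun=> 0)) ?(pfun0 H)//.
    by apply/funext => t; rewrite v00 mule0.
  case: (pfun_lb H) => [n|[m m0 l]]; first by left=> f; exact: n.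
  right; exists (k * m)%R; first exact: mulr_gt0.
  move=> f c c0 f0 fc; rewrite mulrA; apply: l; first by rewrite mulr_ge0// ltW.
    by move=> t _; exact: ge0.
  move=> t _ Bt; rewrite EFinM; apply: lee_pmul; rewrite ?lee_fin ?(ltW k0) ?kv//.
  by apply: fc => //; exact: BP.
Qed.

(** [iterI] integrates the last coordinate outermost, so its step is [bind] of [I K] with the
    shorter iteration, transported along [upd]. The lower bounds multiply. *)
Lemma iterI_pfun (T : Type) (P B : nat -> T -> Prop) (I : nat -> (T -> \bar R) -> \bar R)
    (K : nat) (x0 : nat -> T) :
  (forall k, (k < K)%N -> pfun (P k) (B k) (I k)) ->
  pfun (fun y => forall k, (k < K)%N -> P k (y k)) (fun y => forall k, (k < K)%N -> B k (y k))
    (fun F => iterI I K F x0).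
Proof.
elim: K => [|K IH] H.
  split=> //=; first by move=> f; apply.
    by move=> f g _; apply.
  by right; exists 1%R => // f c _ _ fc; rewrite mulr1; exact: fc.
have {}IH := IH (fun k kK => H k (ltnW kK)).
have Q (A : nat -> T -> Prop) (p : T * (nat -> T)) :
  A K p.1 /\ (forall k, (k < K)%N -> A k (p.2 k)) ->
  forall k, (k < K.+1)%N -> A k (upd p.2 K p.1 k).
  move=> [AK Ak] k; rewrite ltnS /upd leq_eqVlt.
  by case: eqP => [->//|_ /=]; exact: Ak.
apply: (push_pfun (m := fun p : T * (nat -> T) => upd p.2 K p.1)
  (bind_pfun (H K (ltnSn K)) IH)) => p; first exact: Q.
by move=> _; exact: Q.
Qed.

Lemma bind_mass (T1 T2 : Type) P1 B1 P2 B2 (J1 : (T1 -> \bar R) -> \bar R)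
    (J2 : (T2 -> \bar R) -> \bar R) :
  pfun P1 B1 J1 -> pfun P2 B2 J2 -> J1 (fun=> 1) <= 1 -> J2 (fun=> 1) <= 1 ->
  bind J1 J2 (fun=> 1) <= 1.
Proof.
move=> H1 H2 J11 J21; apply: le_trans J11; apply: (pfun_le H1) => // a _.
exact: (pfun_ge0 H2).
Qed.

Lemma iterI_mass (T : Type) (P B : nat -> T -> Prop) (I : nat -> (T -> \bar R) -> \bar R)
    (K : nat) (x0 : nat -> T) :
  (forall k, (k < K)%N -> pfun (P k) (B k) (I k)) ->
  (forall k, (k < K)%N -> I k (fun=> 1) <= 1) -> iterI I K (fun=> 1) x0 <= 1.
Proof.
elim: K => [//|K IH] H M.
have H' k : (k < K)%N -> pfun (P k) (B k) (I k) by move=> kK; apply: H; exact: ltnW.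
apply: (bind_mass (H K (ltnSn K)) (iterI_pfun x0 H')); first exact: M.
by apply: IH => // k kK; apply: M; exact: ltnW.
Qed.

End Functionals.

(** * Functionals as integrals over measurable spaces *)

Section SigmaProduct.
Local Open Scope ereal_scope.
Context d1 d2 (T1 : measurableType d1) (T2 : measurableType d2) (R : realType).
Variables (m1 : {sigma_finite_measure set T1 -> \bar R})
  (m2 : {sigma_finite_measure set T2 -> \bar R}).

(* In the library, the sigma-finite instance of [m1 \x m2] is shadowed by the one for
   subprobabilities. *)
Definition sigma_prod : set (T1 * T2) -> \bar R := m1 \x m2.

HB.instance Definition _ := Measure.copy sigma_prod (m1 \x m2).

Let sigma_prod_sigma_finite : sigma_finite setT sigma_prod.
Proof.
have /sigma_finiteP[F [TF ndF Foo]] := sigma_finiteT m1.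
have /sigma_finiteP[G [TG ndG Goo]] := sigma_finiteT m2.
exists (fun n => F n `*` G n).
  apply/seteqP; split => // -[x y] _.
  have [k _ Fk] : (\bigcup_n F n) x by rewrite -TF.
  have [l _ Gl] : (\bigcup_n G n) y by rewrite -TG.
  exists (k + l)%N => //; split => /=.
    by move: x Fk; apply/subsetPset; apply: ndF; exact: leq_addr.
  by move: y Gl; apply/subsetPset; apply: ndG; exact: leq_addl.
move=> k; have [mF Fk] := Foo k; have [mG Gk] := Goo k.
split; first exact: measurableX.
by rewrite /sigma_prod product_measure1E// lte_mul_pinfty// ge0_fin_numE.
Qed.

HB.instance Definition _ := Measure_isSigmaFinite.Build _ _ _ sigma_prod sigma_prod_sigma_finite.

End SigmaProduct.

Section Representation.
Local Open Scope ereal_scope.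
Variable R : realType.

(* The types integrated over by [iterI] carry no sigma-algebra: measurability of a map into
   them is expressed through a family [c] of real coordinates, and the functional is an integral
   over some auxiliary measurable space. *)
Record repr (T ix : Type) (c : ix -> T -> R) (P : T -> Prop)
    (J : (T -> \bar R) -> \bar R) := Repr {
  rdisp : measure_display ;
  rspace : measurableType rdisp ;
  rmeas : {sigma_finite_measure set rspace -> \bar R} ;
  rmap : rspace -> T ;
  rdens : rspace -> R ;
  rmap_measurable : forall i, measurable_fun setT (fun s => c i (rmap s)) ;
  rdens_measurable : measurable_fun setT rdens ;
  rdens_ge0 : forall s, (0 <= rdens s)%R ;
  rdens_supp : forall s, rdens s != 0%R -> P (rmap s) ;
  reprE : forall F : T -> \bar R, (forall s, 0 <= F (rmap s)) ->
    measurable_fun setT (fun s => F (rmap s)) ->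
    J F = \int[rmeas]_s (F (rmap s) * (rdens s)%:E) }.

Definition sum_coord (ix1 ix2 T1 T2 : Type) (c1 : ix1 -> T1 -> R) (c2 : ix2 -> T2 -> R)
    (i : ix1 + ix2) (p : T1 * T2) : R :=
  match i with inl i => c1 i p.1 | inr i => c2 i p.2 end.

Definition seq_coord (ix T : Type) (c : ix -> T -> R) (i : nat * ix) (y : nat -> T) : R :=
  c i.2 (y i.1).

(** Tonelli on the product of the two auxiliary spaces. The inner functional becomes a section
    integral, which is measurable in the first variable, so that the outer representation applies to
    it. *)
Lemma bind_repr (T1 T2 ix1 ix2 : Type) (c1 : ix1 -> T1 -> R) (c2 : ix2 -> T2 -> R)
    P1 P2 (J1 : (T1 -> \bar R) -> \bar R) (J2 : (T2 -> \bar R) -> \bar R) :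
  repr c1 P1 J1 -> repr c2 P2 J2 ->
  repr (sum_coord c1 c2) (fun p => P1 p.1 /\ P2 p.2) (bind J1 J2).
Proof.
move=> [d1 S1 m1 f1 w1 mf1 mw1 w10 w1P E1] [d2 S2 m2 f2 w2 mf2 mw2 w20 w2P E2].
have mw1f : measurable_fun setT (fun s : S1 * S2 => w1 s.1).
  exact: measurableT_comp mw1 measurable_fst.
have mw2f : measurable_fun setT (fun s : S1 * S2 => w2 s.2).
  exact: measurableT_comp mw2 measurable_snd.
apply: (@Repr _ _ (sum_coord c1 c2) _ _ _ (S1 * S2)%type (sigma_prod m1 m2)
  (fun s => (f1 s.1, f2 s.2)) (fun s => w1 s.1 * w2 s.2)%R).
- case=> i /=.
    exact: (measurableT_comp (mf1 i) measurable_fst).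
  exact: (measurableT_comp (mf2 i) measurable_snd).
- exact: measurable_funM.
- by move=> s; rewrite mulr_ge0.
- by move=> s; rewrite mulf_eq0 negb_or => /andP[/w1P ? /w2P ?].
move=> F F0 mF.
have mFw : measurable_fun setT
    (fun s : S1 * S2 => F (f1 s.1, f2 s.2) * (w2 s.2)%:E).
  by apply: emeasurable_funM => //; exact/measurable_EFinP.
have Fw0 (s : S1 * S2) : 0 <= F (f1 s.1, f2 s.2) * (w2 s.2)%:E.
  by rewrite mule_ge0 ?lee_fin// (F0 s).
have J2E s1 : J2 (fun b => F (f1 s1, b)) = \int[m2]_s2 (F (f1 s1, f2 s2) * (w2 s2)%:E).
  apply: E2 => [s2|]; first exact: (F0 (s1, s2)).
  exact: (measurableT_comp mF (pair1_measurable s1)).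
rewrite /bind E1; first last.
- under eq_fun do rewrite J2E.
  exact: (measurable_fun_fubini_tonelli_F _ mFw Fw0).
- by move=> s1; rewrite J2E; apply: integral_ge0 => s2 _; exact: (Fw0 (s1, s2)).
rewrite /sigma_prod fubini_tonelli1; first last.
- by move=> s; rewrite mule_ge0 ?(F0 s)// lee_fin mulr_ge0.
- by apply: emeasurable_funM => //; apply/measurable_EFinP; exact: measurable_funM.
apply: eq_integral => s1 _; rewrite J2E /fubini_F/=.
rewrite -ge0_integralZr//; first last.
- by rewrite lee_fin.
- by move=> s2 _; exact: (Fw0 (s1, s2)).
- exact: (measurableT_comp mFw (pair1_measurable s1)).
by apply: eq_integral => s2 _; rewrite -muleA -EFinM [in LHS]mulrC.
Qed.

(** With no sigma-algebra on [T] and [T'], measurability of [m] means that composition with it keeps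
    coordinatewise measurability of maps from every measurable space. *)
Lemma push_repr (T T' ix ix' : Type) (c : ix -> T -> R) (c' : ix' -> T' -> R)
    (m : T -> T') P P' (J : (T -> \bar R) -> \bar R) :
  repr c P J ->
  (forall d (S : measurableType d) (f : S -> T),
    (forall i, measurable_fun setT (fun s => c i (f s))) ->
    forall i, measurable_fun setT (fun s => c' i (m (f s)))) ->
  (forall t, P t -> P' (m t)) -> repr c' P' (fun F => J (F \o m)).
Proof.
move=> [d S mu f w mf mw w0 wP E] mm PP.
apply: (@Repr _ _ _ _ _ _ S mu (m \o f) w) => //.
- by move=> i; exact: mm.
- by move=> s /wP; exact: PP.
- by move=> F F0 mF; rewrite E.
Qed.

Lemma weight_repr (T ix : Type) (c : ix -> T -> R) (v : T -> R) P P'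
    (J : (T -> \bar R) -> \bar R) :
  repr c P J -> (forall t, 0 <= v t)%R ->
  (forall d (S : measurableType d) (f : S -> T),
    (forall i, measurable_fun setT (fun s => c i (f s))) ->
    measurable_fun setT (fun s => v (f s))) ->
  (forall t, v t != 0%R -> P t -> P' t) ->
  repr c P' (fun F => J (fun t => F t * (v t)%:E)).
Proof.
move=> [d S mu f w mf mw w0 wP E] v0 mv PP.
apply: (@Repr _ _ _ _ _ _ S mu f (fun s => v (f s) * w s)%R) => //.
- by apply: measurable_funM => //; exact: mv.
- by move=> s; rewrite mulr_ge0.
- by move=> s; rewrite mulf_eq0 negb_or => /andP[/PP ? /wP ?]; auto.
- move=> F F0 mF; rewrite E.
  + by apply: eq_integral => s _; rewrite EFinM muleA.
  + by move=> s; rewrite mule_ge0 ?lee_fin.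
  + by apply: emeasurable_funM => //; apply/measurable_EFinP; exact: mv.
Qed.

Lemma iterI_repr (T ix : Type) (c : ix -> T -> R) (P : nat -> T -> Prop)
    (I : nat -> (T -> \bar R) -> \bar R) (K : nat) (x0 : nat -> T) :
  (forall k, repr c (P k) (I k)) ->
  repr (seq_coord c) (fun y => forall k, (k < K)%N -> P k (y k)) (fun F => iterI I K F x0).
Proof.
move=> H; elim: K => [|K IH].
  (* Integration over no coordinate is evaluation at [x0]: a Dirac mass on a one-point space. *)
  apply: (@Repr _ _ _ _ _ _ unit \d_tt (fun=> x0) (fun=> 1%R)) => //.
  move=> F F0 mF /=; rewrite integral_dirac//.
  by rewrite diracT mul1e mule1.
apply: (push_repr (c' := seq_coord c) (m := fun p : T * (nat -> T) => upd p.2 K p.1)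
  (bind_repr (H K) IH)).
- move=> d S f mf [k i]; rewrite /seq_coord /upd/=; case: (k == K).
    exact: (mf (inl i)).
  exact: (mf (inr (k, i))).
- move=> t [PK Pk] k; rewrite ltnS /upd leq_eqVlt.
  by case: eqP => [->//|_ /=]; exact: Pk.
Qed.

Lemma lebInt_repr (k : nat) :
  repr (fun i (y : nat -> R) => y i) (fun=> True) (lebInt R k).
Proof.
have H : forall k : nat, repr (fun (_ : unit) (t : R) => t) (fun=> True)
    (fun g : R -> \bar R => \int[@lebesgue_measure R]_t g t).
  move=> _; apply: (@Repr _ _ _ _ _ _ (measurableTypeR R) (@lebesgue_measure R) id (fun=> 1%R)) => //.
  by move=> F F0 mF; apply: eq_integral => s _; rewrite mule1.
apply: (push_repr (c' := fun i (y : nat -> R) => y i) (m := id) (iterI_repr k (fun=> 0%R) H)) => //.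
by move=> d S f mf i; exact: (mf (i, tt)).
Qed.

Lemma lebInt_pfun (k : nat) (a b : nat -> R) : (forall j, (j < k)%N -> (a j < b j)%R) ->
  pfun (fun=> True) (fun y => forall j, (j < k)%N -> (a j < y j < b j)%R) (lebInt R k).
Proof.
move=> ab.
apply: (push_pfun (m := id) (iterI_pfun (P := fun _ _ => True)
  (B := fun j t => (a j < t < b j)%R) (fun=> 0%R) _)) => //.
move=> j jk; split.
- by move=> f f0; apply: integral_ge0 => t _; exact: f0.
- by move=> f g f0 fg; apply: le_integral_nonneg => t _; [exact: f0|exact: fg].
- exact: integral0.
- right; exists (b j - a j)%R; first by rewrite subr_gt0 ab.
  move=> f e e0 f0 fe.
  apply: (@le_trans _ _ (\int[lebesgue_measure]_t (e%:E * (\1_(`]a j, b j[%classic) t)%:E))).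
    rewrite ge0_integralZl_EFin//; last exact/measurable_EFinP/measurable_indic.
    have := @lebesgue_measure_itv R `]a j, b j[.
    rewrite /= lte_fin ab// -EFinB integral_indic// setIT => ablen.
    by rewrite EFinM -ablen.
  apply: le_integral_nonneg => t _; first by rewrite mule_ge0 ?lee_fin.
  rewrite indicE; case: (boolP (t \in _)) => [/set_mem|_]; rewrite ?mule1 ?mule0 ?f0//.
  by rewrite /= in_itv/= => ?; exact: fe.
Qed.

End Representation.

(** * The Stiefel manifold and Haar measure *)

Section StiefelAlgebra.
Variable R : realType.

Lemma Stiefel_entry_le1 n p (X : 'M[R]_(n, p)) i j : Stiefel R n p X -> `|X i j| <= 1.
Proof.
move=> /(congr1 (fun A : 'M[R]_p => A j j)); rewrite !mxE eqxx => H.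
rewrite -(ler_sqr (x := `|X i j|)) ?nnegrE// expr1n real_normK ?num_real// -[leRHS]H.
rewrite (bigD1 i)//= !mxE -expr2 lerDl; apply: sumr_ge0 => k _.
by rewrite mxE -expr2 sqr_ge0.
Qed.

Lemma Stiefel_mull n p (Q : 'M[R]_n) (X : 'M[R]_(n, p)) :
  Q^T *m Q = 1%:M -> Stiefel R n p X -> Stiefel R n p (Q *m X).
Proof. by move=> QQ XX; rewrite /Stiefel/= trmx_mul mulmxA -(mulmxA X^T) QQ mulmx1. Qed.

Lemma Stiefel_mulr n p (X : 'M[R]_(n, p)) (V : 'M[R]_p) :
  Stiefel R n p X -> Stiefel R p p V -> Stiefel R n p (X *m V).
Proof. by move=> XX VV; rewrite /Stiefel/= trmx_mul mulmxA -(mulmxA V^T) XX mulmx1. Qed.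

Lemma cV_sqnorm_eq0 n (v : 'cV[R]_n) : (v^T *m v) 0 0 = 0 -> v = 0.
Proof.
rewrite mxE => /eqP; rewrite psumr_eq0 => [|i _]; last by rewrite mxE -expr2 sqr_ge0.
move=> /allP v0; apply/matrixP => i j; rewrite (ord1 j) [RHS]mxE.
have := v0 i (mem_index_enum i).
by rewrite /= !mxE -expr2 sqrf_eq0 => /eqP.
Qed.

Definition dotv n (u v : 'cV[R]_n) : R := (u^T *m v) 0 0.

Lemma dotvC n (u v : 'cV[R]_n) : dotv u v = dotv v u.
Proof. by rewrite /dotv !mxE; apply: eq_bigr => i _; rewrite !mxE mulrC. Qed.

Lemma dotvBl n (u v w : 'cV[R]_n) : dotv (u - v) w = dotv u w - dotv v w.
Proof. by rewrite /dotv linearB/= mulmxBl !mxE. Qed.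

Lemma dotv_col n p (X Y : 'M[R]_(n, p)) i j : dotv (col i X) (col j Y) = (X^T *m Y) i j.
Proof. by rewrite /dotv !mxE; apply: eq_bigr => k _; rewrite !mxE. Qed.

(** The Householder reflection in the hyperplane orthogonal to [v]. *)
Definition reflection n (v : 'cV[R]_n) : 'M[R]_n := 1%:M - (2 / dotv v v) *: (v *m v^T).

Lemma reflectionE n (v x : 'cV[R]_n) :
  reflection v *m x = x - (2 / dotv v v * dotv v x) *: v.
Proof.
rewrite /reflection mulmxBl mul1mx -scalemxAl -mulmxA (mx11_scalar (v^T *m x)).
by rewrite -/(dotv v x) mul_mx_scalar scalerA.
Qed.

Lemma reflection_orthogonal n (v : 'cV[R]_n) : v != 0 ->
  (reflection v)^T *m reflection v = 1%:M.
Proof.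
move=> v0; have q0 : dotv v v != 0 by apply: contra_neq v0; exact: cV_sqnorm_eq0.
rewrite /reflection; set B := _ *: _.
have BT : B^T = B by rewrite /B linearZ/= trmx_mul trmxK.
have BB : B *m B = B + B.
  have vv : v *m v^T *m (v *m v^T) = dotv v v *: (v *m v^T).
    by rewrite mulmxA -(mulmxA v) (mx11_scalar (v^T *m v)) mul_mx_scalar -scalemxAl.
  rewrite /B -scalemxAl -scalemxAr vv !scalerA -scalerDl; congr (_ *: _).
  by rewrite -mulrA divfK// mulr_natr mulr2n.
have -> : (1%:M - B)^T = 1%:M - B by rewrite linearB/= trmx1 BT.
rewrite mulmxBl mul1mx mulmxBr mulmx1 BB.
have -> : B - (B + B) = - B by rewrite opprD addrA subrr sub0r.
by rewrite opprK subrK.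
Qed.

(** Householder's method: once [Q] matches the first [k] columns, the reflection along the
    difference of the next columns matches one more and leaves the previous ones alone. *)
Lemma Stiefel_transitive n p (X Y : 'M[R]_(n, p)) : Stiefel R n p X -> Stiefel R n p Y ->
  exists2 Q : 'M[R]_n, Q^T *m Q = 1%:M & Q *m X = Y.
Proof.
move=> HX HY.
suff H k : (k <= p)%N -> exists2 Q : 'M[R]_n, Q^T *m Q = 1%:M &
    forall j : 'I_p, (j < k)%N -> col j (Q *m X) = col j Y.
  have [Q QQ QX] := H p (leqnn p); exists Q => //.
  apply/matrixP => i j; have /(congr1 (fun A : 'cV[R]_n => A i 0)) := QX j (ltn_ord j).
  by rewrite !mxE.
elim: k => [_|k IH kp]; first by exists 1%:M => //; rewrite trmx1 mulmx1.
have [Q QQ QX] := IH (ltnW kp); pose l := Ordinal kp.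
have HQX := Stiefel_mull QQ HX.
pose v := col l (Q *m X) - col l Y.
have dotQ i j : dotv (col i (Q *m X)) (col j (Q *m X)) = (i == j)%:R.
  by rewrite dotv_col [_ *m _]HQX mxE.
have dotY i j : dotv (col i Y) (col j Y) = (i == j)%:R by rewrite dotv_col [_ *m _]HY mxE.
have [v0|v0] := eqVneq v 0.
  exists Q => // j; rewrite ltnS leq_eqVlt => /orP[/eqP jk|]; last by move=> ?; exact: QX.
  have -> : j = l by exact: val_inj.
  by apply/eqP; rewrite -subr_eq0 -/v v0.
exists (reflection v *m Q).
  by rewrite trmx_mul mulmxA -(mulmxA Q^T) reflection_orthogonal// mulmx1.
have vv0 : dotv v v != 0 by apply: contra_neq v0; exact: cV_sqnorm_eq0.
move=> j; rewrite -mulmxA colE -mulmxA -colE reflectionE ltnS leq_eqVlt => /orP[/eqP jk|jk].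
  have -> : j = l by exact: val_inj.
  (* Both columns are unit vectors, so the coefficient of [v] in the reflection is 1 and the column
     of [Q *m X] goes to itself minus [v], the column of [Y]. *)
  have vv : dotv v v = 2 * dotv v (col l (Q *m X)).
    rewrite {1 3}/v !dotvBl ![dotv _ v]dotvC /v !dotvBl !dotQ !dotY.
    by rewrite (dotvC (col l Y)) eqxx; ring.
  by rewrite mulrAC -vv divff// scale1r subKr.
(* A column already matched is orthogonal to both columns whose difference is [v], so the reflection
   fixes it. *)
have vj : dotv v (col j Y) = 0 by rewrite /v dotvBl dotY -(QX _ jk) dotQ subrr.
by rewrite QX// vj mulr0 scale0r subr0.
Qed.

End StiefelAlgebra.

(** * Borel sets and Borel maps of matrices *)

Section MatrixMeasurability.
Variable R : realType.

Lemma measurable_forall d (T : measurableType d) (I : finType) (P : I -> set T) :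
  (forall i, measurable (P i)) -> measurable [set x | forall i, P i x].
Proof.
move=> mP; rewrite (_ : [set _ | _] = \bigcap_(i in setT) P i).
  by apply: fin_bigcap_measurable => // i _; exact: mP.
by apply/seteqP; split => [x Px i _|x Px i]; exact: Px.
Qed.

Lemma mxB_measurable_open n p (U : set 'M[R]_(n, p)) : open U -> measurable (U : set (mxB R n p)).
Proof. by move=> oU; exact: sub_sigma_algebra. Qed.

Lemma measurable_mx_entry n p (i : 'I_n) (j : 'I_p) :
  measurable_fun setT (fun X : mxB R n p => (X : 'M[R]_(n, p)) i j).
Proof.
apply: (measurability _ (RGenOpens.measurableE R)) => _ [_ [a [b ->] <-]].
rewrite setTI; apply: mxB_measurable_open.
by have /continuousP := @coord_continuous R n p i j; apply; exact: interval_open.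
Qed.

Lemma mulmx_continuous n p (Q : 'M[R]_n) : continuous (fun X : 'M[R]_(n, p) => Q *m X).
Proof.
move=> X A [P nP PA].
have H : \forall Y \near X, forall i j, P i j ((Q *m Y) i j); last first.
  by apply: filterS H => Y HY; exact: PA.
have FX := @nbhs_filter _ X.
apply: (filter_forall (f := fun i Y => forall j, P i j ((Q *m Y) i j)) FX) => i.
apply: (filter_forall (f := fun j Y => P i j ((Q *m Y) i j)) FX) => j.
have : continuous (fun Y : 'M[R]_(n, p) => (Q *m Y) i j).
  under eq_fun do rewrite mxE.
  apply: continuous_big => [|k _]; first exact: add_continuous.
  by move=> Y; apply: continuousM; [exact: cst_continuous|exact: coord_continuous].
by move=> /(_ X); apply; exact: nP.
Qed.

Lemma measurable_mulmx n p (Q : 'M[R]_n) :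
  measurable_fun setT (fun X : mxB R n p => (Q *m X : mxB R n p)).
Proof.
apply: (measurability _ (erefl : @measurable _ (mxB R n p) = <<s @open 'M[R]_(n, p) >>)).
move=> _ [A oA <-]; rewrite setTI; apply: mxB_measurable_open.
by have /continuousP := @mulmx_continuous n p Q; exact.
Qed.

(** A named form of left multiplication, to which the structure of measurable function is attached
    so that its pushforward can be formed. *)
Definition lmulmx n p (Q : 'M[R]_n) (X : mxB R n p) : mxB R n p := Q *m X.

HB.instance Definition _ n p (Q : 'M[R]_n) :=
  isMeasurableFun.Build _ _ _ _ (@lmulmx n p Q) (@measurable_mulmx n p Q).

Lemma measurable_Stiefel n p : measurable (Stiefel R n p : set (mxB R n p)).
Proof.
rewrite (_ : Stiefel R n p = [set X | forall i j, (X^T *m X) i j = (1%:M : 'M[R]_p) i j]).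
  apply: measurable_forall => i; apply: measurable_forall => j.
  rewrite -[X in measurable X]setTI.
  have mf : measurable_fun setT (fun X : mxB R n p => ((X : 'M[R]_(n, p))^T *m X) i j).
    under eq_fun do rewrite mxE.
    apply: measurable_sum => k; under eq_fun do rewrite mxE.
    by apply: measurable_funM; exact: measurable_mx_entry.
  exact: (mf measurableT _ (measurable_set1 ((1%:M : 'M[R]_p) i j))).
by apply/seteqP; split => [X HX i j|X HX]; [rewrite HX|exact/matrixP].
Qed.

Lemma measurable_StiefelTilde n p : measurable (StiefelTilde R n p : set (mxB R n p)).
Proof.
apply: measurableI; first exact: measurable_Stiefel.
apply: measurable_forall => i.
apply: (measurable_forall (P := fun j => [set X : mxB R n p | (i : nat) = 0%N ->
  0 < (X : 'M[R]_(n, p)) i j])) => j.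
have [i0|i0] := eqVneq (i : nat) 0%N; last first.
  by rewrite (_ : [set _ | _] = setT)//; apply/seteqP; split => // X _ /eqP; rewrite (negbTE i0).
rewrite (_ : [set _ | _] = (fun X : mxB R n p => (X : 'M[R]_(n, p)) i j) @^-1` `]0, +oo[).
  by rewrite -[X in measurable X]setTI; exact: measurable_mx_entry.
by apply/seteqP; split => X /=; rewrite in_itv/= andbT => // H; exact: H.
Qed.

(** The preimage of an interval is relatively open, hence the trace on the manifold of an open set
    of matrices. *)
Lemma measurable_within_Stiefel n p (g : 'M[R]_(n, p) -> R) :
  {within Stiefel R n p, continuous g} ->
  measurable_fun (Stiefel R n p : set (mxB R n p)) (g : mxB R n p -> R).
Proof.
move=> /continuousP cg; apply: (measurability _ (RGenOpens.measurableE R)).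
move=> _ [_ [a [b ->] <-]].
have oab : open (from_subspace (Stiefel R n p) g @^-1` `]a, b[%classic).
  exact/cg/interval_open.
have [V oV VE] := (@open_subspaceP _ (Stiefel R n p) _).1 oab.
rewrite setIC -VE; apply: measurableI; last exact: measurable_Stiefel.
exact: mxB_measurable_open.
Qed.

Definition mx_box n p (M : 'M[R]_(n, p)) (r : R) : set 'M[R]_(n, p) :=
  [set X | forall i j, `|X i j - M i j| < r].

Lemma measurable_mx_box n p (M : 'M[R]_(n, p)) r :
  measurable (mx_box M r : set (mxB R n p)).
Proof.
apply: measurable_forall => i.
apply: (measurable_forall (P := fun j => [set X : mxB R n p |
  `|(X : 'M[R]_(n, p)) i j - M i j| < r])) => j.
rewrite (_ : [set _ | _] =
  (fun X : mxB R n p => `|(X : 'M[R]_(n, p)) i j - M i j|) @^-1` `]-oo, r[).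
  rewrite -[X in measurable X]setTI.
  have mf : measurable_fun setT (fun X : mxB R n p => `|(X : 'M[R]_(n, p)) i j - M i j|).
    apply: measurableT_comp => //; apply: measurable_funB => //.
    exact: measurable_mx_entry.
  exact: (mf measurableT _ (measurable_itv _)).
by apply/seteqP; split => X /=; rewrite in_itv.
Qed.

End MatrixMeasurability.

(** * Invariance of Haar measure and its positivity on balls *)

Section Haar.
Variables (R : realType) (n p : nat) (mu : probability (mxB R n p) R).
Hypothesis hmu : is_haar_stiefel R n p mu.

Lemma haar_setCStiefel : mu (~` (Stiefel R n p : set (mxB R n p))) = 0%E.
Proof.
by rewrite probability_setC ?hmu.1 ?subee//; exact: measurable_Stiefel.
Qed.

Lemma haar_integral_mull (Q : 'M[R]_n) (f : mxB R n p -> \bar R) :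
  Q^T *m Q = 1%:M -> measurable_fun setT f -> (forall X, 0 <= f X)%E ->
  (\int[mu]_X f (Q *m X : mxB R n p) = \int[mu]_X f X)%E.
Proof.
move=> QQ mf f0.
transitivity (\int[pushforward mu (@lmulmx R n p Q)]_X f X)%E.
  by rewrite ge0_integral_pushforward//; exact: measurable_mulmx.
by apply: eq_measure_integral => A mA _; exact: hmu.2.
Qed.

(** Countably many small cells cover the manifold. An orthogonal matrix taking one frame of a cell
    to [M] takes all frames of the cell into the box, so by invariance a null box would make every
    cell null, and with them the whole manifold. *)
Lemma haar_mx_box_gt0 (M : 'M[R]_(n, p)) (r : R) : Stiefel R n p M -> 0 < r ->
  (0 < mu (mx_box M r))%E.
Proof.
move=> HM r0; rewrite lt0e measure_ge0 andbT; apply/eqP => M0.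
(* Frames of one cell differ by less than 1/L in each entry. An entry of Q (X - Y) is a sum of [n]
   products with entries of [Q] bounded by 1, hence at most n/L, which is less than [r]. *)
pose L : R := n%:R / r + 1.
have L0 : 0 < L by rewrite ltr_wpDl// divr_ge0// ltW.
(* The integer parts of the scaled entries, encoded as one natural number so that the cells form a
   sequence. *)
pose cell (X : 'M[R]_(n, p)) : nat := choice.pickle (map_mx (fun x => Num.floor (L * x)) X).
have H : mu.-negligible (\bigcup_k (Stiefel R n p `&` [set X | cell X = k] : set (mxB R n p))).
  apply: negligible_bigcup => k.
  have [[Y [HY Yk]]|] := pselect (exists X, Stiefel R n p X /\ cell X = k); last first.
    move=> nX; rewrite (_ : _ `&` _ = set0); first exact: negligible_set0.
    by apply/seteqP; split => // X [HX Xk]; apply: nX; exists X.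
  have [Q QQ QY] := Stiefel_transitive HY HM.
  exists ((fun X : mxB R n p => (Q *m X : mxB R n p)) @^-1` mx_box M r); split.
  - rewrite -[X in measurable X]setTI; apply: measurable_mulmx => //.
    exact: measurable_mx_box.
  - by rewrite -[RHS]M0; apply: hmu.2 => //; exact: measurable_mx_box.
  - move=> X [HX Xk] i j /=.
    have XY k' j' : `|X k' j' - Y k' j'| < L^-1.
      have : cell X = cell Y by rewrite Xk Yk.
      move=> /(pcan_inj choice.pickleK)/matrixP/(_ k' j'); rewrite !mxE => E.
      have := Num.Theory.floor_itv (L * X k' j').
      have := Num.Theory.floor_itv (L * Y k' j').
      rewrite E intrD => /andP[h1 h2] /andP[h3 h4].
      rewrite -[X in _ < X]mul1r ltr_pdivlMr// mulrC -[X in X * _]gtr0_norm// -normrM.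
      by rewrite ltr_norml; apply/andP; split; nra.
    rewrite -QY !mxE -sumrB.
    apply: (@le_lt_trans _ _ (\sum_(k' < n) L^-1)).
      apply: (le_trans (ler_norm_sum _ _ _)); apply: ler_sum => k' _.
      rewrite -mulrBr normrM -[leRHS]mul1r ler_pM// ?(Stiefel_entry_le1 _ _ QQ)//.
      exact/ltW/XY.
    rewrite sumr_const card_ord -mulr_natl ltr_pdivrMr// /L mulrDr mulr1 mulrCA divff ?gt_eqF//.
    by rewrite mulr1 ltrDl.
have : mu.-negligible (Stiefel R n p : set (mxB R n p)).
  apply: negligibleS H => X HX; by exists (cell X).
move=> /(negligibleP mu (@measurable_Stiefel R n p)) mu0.
by have := hmu.1; rewrite mu0 => /eqP; rewrite eq_sym onee_eq0.
Qed.

End Haar.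

(** * The matrix Langevin family *)

Section ParametricMeasurability.
Variable R : realType.
Context d (S : measurableType d).

Definition entrywise_measurable m n (A : S -> 'M[R]_(m, n)) :=
  forall i j, measurable_fun setT (fun s => A s i j).

Lemma entrywise_mulmx m n k (A : S -> 'M[R]_(m, n)) (B : S -> 'M[R]_(n, k)) :
  entrywise_measurable A -> entrywise_measurable B ->
  entrywise_measurable (fun s => A s *m B s).
Proof.
move=> mA mB i j; under eq_fun do rewrite mxE.
by apply: measurable_sum => l; apply: measurable_funM; [exact: mA|exact: mB].
Qed.

Lemma entrywise_trmx m n (A : S -> 'M[R]_(m, n)) :
  entrywise_measurable A -> entrywise_measurable (fun s => (A s)^T).
Proof. by move=> mA i j; under eq_fun do rewrite mxE; exact: mA. Qed.

Lemma entrywise_cst m n (A : 'M[R]_(m, n)) : entrywise_measurable (fun=> A).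
Proof. by move=> i j. Qed.

Lemma entrywise_diagp p (v : S -> nat -> R) : (forall j, measurable_fun setT (fun s => v s j)) ->
  entrywise_measurable (fun s => diagp R p (v s)).
Proof.
move=> mv i j; under eq_fun do rewrite mxE.
by case: (i == j); [exact: (mv i)|exact: measurable_cst].
Qed.

Lemma measurable_etr m (A : S -> 'M[R]_m) : entrywise_measurable A ->
  measurable_fun setT (fun s => etr R m (A s)).
Proof.
by move=> mA; apply: measurableT_comp => //; apply: measurable_sum => i; exact: mA.
Qed.

Lemma measurable_invr_ge0 (f : S -> R) : (forall s, 0 <= f s) ->
  measurable_fun setT f -> measurable_fun setT (fun s => (f s)^-1).
Proof.
move=> f0 mf; rewrite (_ : (fun _ => _) = (fun s => f s `^ (-1))).
  exact: (measurableT_comp (measurable_powR (-1)) mf).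
by apply/funext => s; rewrite powR_inv1.
Qed.

Context dT (T : measurableType dT) (mu : probability T R).

(** Tonelli for the positive and negative parts, extended by zero outside [D]; the integral is their
    difference by definition. *)
Lemma measurable_integral_param (D : set T) (f : S -> T -> \bar R) : measurable D ->
  measurable_fun setT (fun st : S * T => f st.1 st.2) ->
  measurable_fun setT (fun s => \int[mu]_(x in D) f s x)%E.
Proof.
move=> mD mf.
have mDf (g : S -> T -> \bar R) : (forall s x, 0 <= g s x)%E ->
    measurable_fun setT (fun st : S * T => g st.1 st.2) ->
    measurable_fun setT (fun s => \int[mu]_(x in D) g s x)%E.
  move=> g0 mg; under eq_fun do rewrite integral_mkcond.
  apply: (measurable_fun_fubini_tonelli_F (fun st : S * T => (g st.1 \_ D) st.2)).
    rewrite (_ : (fun _ => _) = (fun st : S * T => g st.1 st.2 * (\1_D st.2)%:E)%E).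
      apply: emeasurable_funM => //; apply/measurable_EFinP.
      by apply: (measurableT_comp (f := \1_D : T -> R)) => //; exact: measurable_indic.
    apply/funext => st; rewrite patchE indicE.
    by case: ifPn => _; rewrite ?mule1 ?mule0.
  by move=> st; rewrite patchE; case: ifPn.
under eq_fun do rewrite integralE.
apply: emeasurable_funB.
  apply: (mDf (fun s => (f s)^\+)%E) => [s x|]; first exact: funepos_ge0.
  rewrite (_ : (fun _ => _) = (fun st : S * T => f st.1 st.2)^\+%E).
    exact: measurable_funepos.
  by apply/funext => st; rewrite !unlock.
apply: (mDf (fun s => (f s)^\-)%E) => [s x|]; first exact: funeneg_ge0.
rewrite (_ : (fun _ => _) = (fun st : S * T => f st.1 st.2)^\-%E).
  exact: measurable_funeneg.
by apply/funext => st; rewrite !unlock.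
Qed.

Lemma measurable_Rintegral_param (D : set T) (f : S -> T -> R) : measurable D ->
  measurable_fun setT (fun st : S * T => f st.1 st.2) ->
  measurable_fun setT (fun s => Rintegral mu D (f s)).
Proof.
move=> mD mf; apply: measurableT_comp; first exact: fine_measurable.
by apply: measurable_integral_param => //; exact/measurable_EFinP.
Qed.

End ParametricMeasurability.

Section LangevinNormalization.
Variables (R : realType) (n p : nat) (mu : probability (mxB R n p) R).
Hypothesis hmu : is_haar_stiefel R n p mu.

Definition l1norm m k (A : 'M[R]_(m, k)) : R := \sum_i \sum_j `|A i j|.

Lemma mxtrace_le_l1norm (A : 'M[R]_(p, n)) (X : 'M[R]_(n, p)) : Stiefel R n p X ->
  `|\tr (A *m X)| <= l1norm A.
Proof.
move=> HX; apply: (le_trans (ler_norm_sum _ _ _)); apply: ler_sum => i _.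
rewrite mxE; apply: (le_trans (ler_norm_sum _ _ _)); apply: ler_sum => j _.
by rewrite normrM ler_piMr// (Stiefel_entry_le1 _ _ HX).
Qed.

Lemma etr_bounds (A : 'M[R]_(p, n)) (X : 'M[R]_(n, p)) : Stiefel R n p X ->
  expR (- l1norm A) <= etr R p (A *m X) <= expR (l1norm A).
Proof. by move=> HX; rewrite /etr !ler_expR -ler_norml mxtrace_le_l1norm. Qed.

Lemma entrywise_mxB d (S : measurableType d) (X : S -> mxB R n p) :
  measurable_fun setT X -> entrywise_measurable (X : S -> 'M[R]_(n, p)).
Proof. by move=> mX i j; apply: (measurableT_comp (measurable_mx_entry i j) mX). Qed.

Lemma entrywise_id : entrywise_measurable (fun X : mxB R n p => (X : 'M[R]_(n, p))).
Proof. by move=> i j; exact: measurable_mx_entry. Qed.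

Lemma Stiefel_integrable (f : mxB R n p -> R) (B : R) :
  measurable_fun (Stiefel R n p : set (mxB R n p)) f ->
  (forall X, Stiefel R n p X -> `|f X| <= B) ->
  mu.-integrable (Stiefel R n p : set (mxB R n p)) (EFin \o f).
Proof.
move=> mf fB; apply: measurable_bounded_integrable => //.
- exact: measurable_Stiefel.
- by rewrite (le_lt_trans (probability_le1 _ _)) ?ltry//; exact: measurable_Stiefel.
- exists B; split; first exact: num_real.
  by move=> x Bx X HX; rewrite /= (le_trans (fB _ HX))// ltW.
Qed.

Lemma Stiefel_Rintegral_cst (r : R) : Rintegral mu (Stiefel R n p : set (mxB R n p)) (fun=> r) = r.
Proof.
transitivity (r * fine (mu (Stiefel R n p : set (mxB R n p)))); last by rewrite hmu.1 mulr1.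
by apply: Rintegral_cst; exact: measurable_Stiefel.
Qed.

Lemma haar_integralT (f : mxB R n p -> \bar R) : measurable_fun setT f ->
  (forall X, 0 <= f X)%E ->
  (\int[mu]_(X in Stiefel R n p : set (mxB R n p)) f X = \int[mu]_X f X)%E.
Proof.
move=> mf f0; rewrite [RHS](@ge0_negligible_integral _ _ _ _ setT (~` (Stiefel R n p : set (mxB R n p))))//.
- by rewrite setTD setCK.
- by apply: measurableC; exact: measurable_Stiefel.
- exact: haar_setCStiefel.
Qed.

Lemma etr_integrable (A : 'M[R]_(p, n)) :
  mu.-integrable (Stiefel R n p : set (mxB R n p)) (EFin \o (fun X : mxB R n p => etr R p (A *m X))).
Proof.
apply: (Stiefel_integrable (B := expR (l1norm A))) => [|X HX].
  apply: measurable_funTS; apply: measurable_etr.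
  by apply: entrywise_mulmx; [exact: entrywise_cst|exact: entrywise_id].
by rewrite ger0_norm ?expR_ge0//; case/andP: (etr_bounds A HX).
Qed.

Definition etr_mean (A : 'M[R]_(p, n)) : R :=
  Rintegral mu (Stiefel R n p : set (mxB R n p)) (fun X : mxB R n p => etr R p (A *m X)).

(** Integrates a pointwise comparison: entries of a frame are at most 1, so tr((A' - A) X) is at
    most the [l1norm] of A' - A. The logarithm of [etr_mean] is thus 1-Lipschitz. *)
Lemma etr_mean_le (A A' : 'M[R]_(p, n)) :
  etr_mean A' <= expR (l1norm (A' - A)) * etr_mean A.
Proof.
have mS := @measurable_Stiefel R n p.
rewrite /etr_mean -RintegralZl//; last exact: etr_integrable.
apply: le_Rintegral => //; first exact: etr_integrable.
  apply: (Stiefel_integrable (B := expR (l1norm (A' - A)) * expR (l1norm A))) => [|X HX].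
    apply: measurable_funTS; apply: measurable_funM => //; apply: measurable_etr.
    by apply: entrywise_mulmx; [exact: entrywise_cst|exact: entrywise_id].
  rewrite ger0_norm ?mulr_ge0 ?expR_ge0// ler_wpM2l ?expR_ge0//.
  by case/andP: (etr_bounds A HX).
move=> X HX; rewrite /etr -expRD ler_expR -lerBlDr -linearB/= -mulmxBl.
by rewrite (le_trans (ler_norm _))// mxtrace_le_l1norm.
Qed.

Lemma etr_mean0 : etr_mean 0 = 1.
Proof.
rewrite -[RHS](Stiefel_Rintegral_cst); apply: eq_Rintegral => X _.
by rewrite mul0mx /etr mxtrace0 expR0.
Qed.

(** Comparison with the zero matrix, whose mean is 1, in both directions. *)
Lemma etr_mean_bounds (A : 'M[R]_(p, n)) :
  expR (- l1norm A) <= etr_mean A <= expR (l1norm A).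
Proof.
apply/andP; split; last first.
  by rewrite (le_trans (etr_mean_le 0 A))// subr0 etr_mean0 mulr1.
have := etr_mean_le A 0; rewrite etr_mean0 sub0r expRN.
rewrite (_ : l1norm (- A) = l1norm A).
  by move=> H; rewrite -[leLHS]mul1r ler_pdivrMr ?expR_gt0// mulrC.
by apply: eq_bigr => i _; apply: eq_bigr => j _; rewrite mxE normrN.
Qed.

Lemma etr_mean_gt0 (A : 'M[R]_(p, n)) : 0 < etr_mean A.
Proof. by case/andP: (etr_mean_bounds A) => + _; apply: lt_le_trans; exact: expR_gt0. Qed.

Definition id_frame : 'M[R]_(n, p) := \matrix_(i, j) ((i : nat) == j)%:R.

(** Puts the normalizing constant in the same form as the numerator, with V = 1 and M the standard
    frame, so that facts on [etr_mean] serve both. *)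
Lemma F01E v : F01 R n p mu v = etr_mean (diagp R p v *m id_frame^T).
Proof.
apply: eq_Rintegral => X _; congr expR.
rewrite /mxtrace exchange_big/=; apply: eq_bigr => j _.
rewrite mxE; apply: eq_bigr => i _; rewrite mxE (bigD1 j)//= !mxE eqxx big1 ?addr0.
  by rewrite [v j * _]mulrC.
by move=> k kj; rewrite !mxE eq_sym (negbTE kj) mul0r.
Qed.

(* Averaging [etr (D Y^T X W)] over both [X] and [Y] and transposing exchanges the roles of the two
   variables, which turns left invariance of the measure into independence of [W]. *)
Lemma etr_mean_frame (v : nat -> R) (M M' : 'M[R]_(n, p)) (W : 'M[R]_p) :
  Stiefel R n p M -> Stiefel R n p M' -> Stiefel R p p W ->
  etr_mean (W *m diagp R p v *m M^T) = etr_mean (diagp R p v *m M'^T).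
Proof.
move=> HM HM' HW; set D := diagp R p v.
pose h (Z : 'M[R]_p) : \bar R := (etr R p (D *m Z))%:E.
have h0 Z : (0 <= h Z)%E by rewrite lee_fin expR_ge0.
have mh d (S : measurableType d) (Z : S -> 'M[R]_p) : entrywise_measurable Z ->
    measurable_fun setT (fun s => h (Z s)).
  move=> mZ; apply/measurable_EFinP; apply: measurable_etr.
  by apply: entrywise_mulmx => //; exact: entrywise_cst.
have DT : D^T = D.
  by apply/matrixP => i j; rewrite !mxE eq_sym; case: eqP => // ->.
have hT Y Z : h (Y^T *m Z) = h (Z^T *m Y).
  rewrite /h /etr -mxtrace_tr trmx_mul DT trmx_mul trmxK mxtrace_mulC.
  by [].
have mfst := entrywise_mxB (@measurable_fst _ _ (mxB R n p) (mxB R n p)).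
have msnd := entrywise_mxB (@measurable_snd _ _ (mxB R n p) (mxB R n p)).
have mid := entrywise_id.
have mcst k l (A : 'M[R]_(k, l)) := @entrywise_cst R _ (mxB R n p) _ _ A.
(* Replacing [Y] by [Q *m Y] amounts to a left translation of [X], and the orthogonal group is
   transitive on frames. *)
have left_inv (Y Y' : 'M[R]_(n, p)) (U : 'M[R]_p) : Stiefel R n p Y -> Stiefel R n p Y' ->
    (\int[mu]_X h (Y^T *m X *m U) = \int[mu]_X h (Y'^T *m X *m U))%E.
  move=> HY HY'; have [Q QQ <-] := Stiefel_transitive HY HY'.
  pose f (X : mxB R n p) : \bar R := h ((Q *m Y)^T *m X *m U).
  have mf : measurable_fun setT f.
    by apply: mh; apply: entrywise_mulmx => //; exact: entrywise_mulmx.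
  transitivity (\int[mu]_X f (Q *m X : mxB R n p))%E.
    apply: eq_integral => X _.
    by rewrite /f trmx_mul !mulmxA -[Y^T *m Q^T *m Q]mulmxA QQ mulmx1.
  exact: (haar_integral_mull hmu QQ mf (fun=> h0 _)).
have key U : Stiefel R p p U ->
    (\int[mu]_X h (M'^T *m X *m U) = \int[mu]_X h (M'^T *m X))%E.
  move=> HU.
  have mF : measurable_fun setT (fun YX : mxB R n p * mxB R n p => h (YX.1^T *m YX.2 *m U)).
    apply: mh; apply: entrywise_mulmx; last exact: entrywise_cst.
    by apply: entrywise_mulmx => //; exact: entrywise_trmx.
  have cstS (c : \bar R) : (c = \int[mu]_(Y in Stiefel R n p : set (mxB R n p)) c)%E.
    transitivity (c * mu (Stiefel R n p : set (mxB R n p)))%E; first by rewrite hmu.1 mule1.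
    by apply/esym/integral_cst; exact: measurable_Stiefel.
  rewrite [LHS]cstS [RHS]cstS.
  pose f1 (Y : mxB R n p) := (\int[mu]_X h (Y^T *m X *m U))%E.
  pose f2 (X : mxB R n p) := (\int[mu]_Y h (Y^T *m X *m U))%E.
  have mf1 : measurable_fun setT f1 := measurable_fun_fubini_tonelli_F _ mF (fun=> h0 _).
  have mf2 : measurable_fun setT f2 := measurable_fun_fubini_tonelli_G _ mF (fun=> h0 _).
  (* By [left_inv] the left side does not change when M' is replaced by any frame [Y], hence equals
     its own average over [Y]. Tonelli then puts the integral over [Y] inside. *)
  transitivity (\int[mu]_(Y in Stiefel R n p : set (mxB R n p)) f1 Y)%E.
    by apply: eq_integral => Y /set_mem HY; exact: left_inv.
  transitivity (\int[mu]_Y f1 Y)%E.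
    by apply: haar_integralT => // Y; exact: integral_ge0.
  transitivity (\int[mu]_X f2 X)%E; first exact: (fubini_tonelli _ mF (fun=> h0 _)).
  transitivity (\int[mu]_(X in Stiefel R n p : set (mxB R n p)) f2 X)%E.
    by apply/esym/haar_integralT => // X; exact: integral_ge0.
  apply: eq_integral => X /set_mem HX; rewrite /f2.
  (* For fixed [X], transposition moves X U to the left factor. It is again a frame, so [left_inv]
     trades it for M', and [U] has disappeared. *)
  transitivity (\int[mu]_Y h ((X *m U)^T *m Y *m 1%:M))%E.
    by apply: eq_integral => Y _; rewrite mulmx1 -mulmxA hT.
  transitivity (\int[mu]_Y h (M'^T *m Y *m 1%:M))%E.
    by apply: left_inv => //; exact: Stiefel_mulr.
  by apply: eq_integral => Y _; rewrite mulmx1.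
have E (A : 'M[R]_(p, n)) : etr_mean A = fine (\int[mu]_X (etr R p (A *m X))%:E)%E.
  congr fine; apply: haar_integralT => [|X]; last by rewrite lee_fin expR_ge0.
  by apply/measurable_EFinP; apply: measurable_etr; exact: entrywise_mulmx.
rewrite [LHS]E [RHS]E; apply: (congr1 fine).
transitivity (\int[mu]_X h (M^T *m X *m W))%E.
  apply: eq_integral => X _; apply: (congr1 (fun t => (expR t)%:E)).
  by rewrite -!mulmxA mxtrace_mulC !mulmxA.
transitivity (\int[mu]_X h (M'^T *m X *m W))%E; first exact: left_inv.
transitivity (\int[mu]_X h (M'^T *m X))%E; first exact: key.
by apply: eq_integral => X _; rewrite /h mulmxA.
Qed.

Hypothesis hpn : (p <= n)%N.

Lemma id_frame_Stiefel : Stiefel R n p id_frame.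
Proof.
apply/matrixP => i j; rewrite !mxE (bigD1 (widen_ord hpn i))//= !mxE eqxx mul1r big1.
  by rewrite addr0.
move=> k ki; rewrite !mxE (_ : (k : nat) == i = false) ?mul0r//.
by apply: contra_neqF ki => /eqP ki; exact: val_inj.
Qed.

Lemma fML_integral (v : nat -> R) (M : 'M[R]_(n, p)) (V : 'M[R]_p) :
  Stiefel R n p M -> Stiefel R p p V ->
  Rintegral mu (Stiefel R n p : set (mxB R n p)) (fML R n p mu M v V) = 1.
Proof.
move=> HM HV; rewrite /fML RintegralZr; [|exact: measurable_Stiefel|exact: etr_integrable].
rewrite F01E -/(etr_mean _) (etr_mean_frame v HM id_frame_Stiefel HV).
by rewrite divff// gt_eqF// etr_mean_gt0.
Qed.

End LangevinNormalization.

(** * Independent samples *)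

Section Probability.
Variable R : realType.

(** Markov gives probability at most K (r/s)^N to the failure at [N]; the gap between [r] and [s]
    makes this summable, and Borel-Cantelli applies. *)
Lemma ae_eventually_lt d (T : measurableType d) (P : probability T R)
    (Y : nat -> T -> \bar R) (K r s : R) :
  0 <= K -> 0 < r < s -> (forall N, measurable_fun setT (Y N)) ->
  (forall N w, 0 <= Y N w)%E -> (forall N, \int[P]_w Y N w <= (K * r ^+ N)%:E)%E ->
  \forall w \ae P, \forall N \near \oo, (Y N w < (s ^+ N)%:E)%E.
Proof.
move=> K0 /andP[r0 rs] mY Y0 YK; have s0 := lt_trans r0 rs.
pose A N := [set w | ((s ^+ N)%:E <= Y N w)%E].
have mA N : measurable (A N).
  by rewrite -[A N]setTI; apply: emeasurable_fun_c_infty.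
have PA N : (P (A N) <= (K * (r / s) ^+ N)%:E)%E.
  have sN : 0 < s ^+ N by rewrite exprn_gt0.
  rewrite -(@lee_pmul2l _ (s ^+ N)%:E)// -EFinM.
  have -> : s ^+ N * (K * (r / s) ^+ N) = K * r ^+ N.
    by rewrite expr_div_n; field; rewrite gt_eqF.
  apply: le_trans (YK N).
  have := le_integral_abse P measurableT (mY N) sN.
  rewrite setTI (_ : [set x | _] = A N).
    by under eq_integral do rewrite gee0_abs//.
  by apply/seteqP; split => w; rewrite /A/= gee0_abs.
have z1 : `|r / s| < 1 by rewrite ger0_norm ?divr_ge0 1?ltW// ltr_pdivrMr// mul1r.
have PL : P (lim_sup_set A) = 0%E.
  apply: lim_sup_set_cvg0 => //.
  apply: (@le_lt_trans _ _ (K * (1 - r / s)^-1)%:E); last exact: ltry.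
  apply: lime_le; first exact: is_cvg_nneseries.
  apply: nearW => n; apply: (@le_trans _ _ (\sum_(0 <= k < n) (K * (r / s) ^+ k)%:E)%E).
    by apply: lee_sum => k _; exact: PA.
  by rewrite sumEFin lee_fin; apply: (geometric_le_lim n) => //; rewrite divr_gt0.
exists (lim_sup_set A); split => //.
  by apply: bigcapT_measurable => k; apply: bigcup_measurable.
move=> w /= nw n _; apply: contrapT => nb; apply: nw; exists n => // k /= nk.
by rewrite ltNge; apply/negP => sY; apply: nb; exists k.
Qed.

Variables (n p : nat) (dO : measure_display) (Omega : measurableType dO)
  (P : probability Omega R) (X : nat -> Omega -> mxB R n p).
Hypothesis hXmeas : forall i, measurable_fun setT (X i).
Hypothesis hXind : mutually_independent R dO Omega n p P X.

(** Independence is stated for events. Expanding the product of sums gives one term for each map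
    from 'I_N to [I], and each term is a multiple of the indicator of an intersection of events on
    distinct observations. *)
Lemma step_product_integral (I : finType) (a : I -> R) (E : I -> set (mxB R n p)) N :
  (forall i, 0 <= a i) -> (forall i, measurable (E i)) ->
  (\int[P]_w (\prod_(j < N) \sum_i (a i * \1_(E i) (X j w)))%:E =
   (\prod_(j < N) \sum_i a i * fine (P (X j @^-1` E i)))%:E)%E.
Proof.
move=> a0 mE.
have mXE j i : measurable (X j @^-1` E i) by rewrite -[X in measurable X]setTI; exact: hXmeas.
(* [mutually_independent] takes sets indexed by all naturals, so the finite family is completed with
   the full set. *)
pose A (g : {ffun 'I_N -> I}) (i : nat) : set (mxB R n p) :=
  if insub i is Some j then E (g j) else setT.
pose B (g : {ffun 'I_N -> I}) := [set w | forall i, i \in iota 0 N -> A g i (X i w)].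
have BE g w : B g w <-> forall j : 'I_N, E (g j) (X j w).
  split => [Bw j|Bw i].
    by have := Bw (j : nat); rewrite mem_iota/= add0n ltn_ord /A valK; exact.
  by rewrite mem_iota add0n/= => iN; rewrite /A insubT; exact: (Bw (Ordinal iN)).
have mB g : measurable (B g).
  rewrite (_ : B g = [set w | forall j : 'I_N, E (g j) (X j w)]); last first.
    by apply/seteqP; split => w /BE.
  by apply: measurable_forall => j; exact: mXE.
have PB g : P (B g) = (\prod_(j < N) fine (P (X j @^-1` E (g j))))%:E.
  have mA i : measurable (A g i) by rewrite /A; case: insubP.
  transitivity (\big[*%E/1%E]_(i <- iota 0 N) P (X i @^-1` A g i))%E.
    by apply: hXind => //; exact: iota_uniq.
  rewrite (_ : iota 0 N = index_iota 0 N) ?big_mkord; last by rewrite /index_iota subn0.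
  rewrite -prodEFin; apply: eq_bigr => j _.
  by rewrite /A valK fineK// fin_num_measure.
have indB (g : {ffun 'I_N -> I}) w : \prod_(j < N) \1_(E (g j)) (X j w) = \1_(B g) w :> R.
  rewrite [RHS]indicE; case: (boolP (w \in B g)) => [/set_mem /BE Bw|/negP nBw].
    by rewrite big1// => j _; rewrite indicE mem_set.
  have /existsNP[j Ej] : ~ forall j : 'I_N, E (g j) (X j w).
    by move=> Bw; apply: nBw; apply/mem_set/BE.
  by rewrite (bigD1 j)//= indicE memNset// mul0r.
transitivity (\int[P]_w (\sum_(g : {ffun 'I_N -> I}) ((\prod_(j < N) a (g j)) * \1_(B g) w)%:E))%E.
  apply: eq_integral => w _; rewrite sumEFin; congr (_%:E).
  rewrite bigA_distr_bigA/=; apply: eq_bigr => g _.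
  by rewrite big_split/= indB.
have pa0 (g : {ffun 'I_N -> I}) : 0 <= \prod_(j < N) a (g j) by apply: prodr_ge0.
rewrite ge0_integral_sum//; first last.
- by move=> g w _; rewrite lee_fin mulr_ge0.
- by move=> g; apply/measurable_EFinP; apply: measurable_funM => //; exact: measurable_indic.
rewrite bigA_distr_bigA/= -sumEFin; apply: eq_bigr => g _.
rewrite big_split/= EFinM -PB.
under eq_integral do rewrite EFinM.
rewrite ge0_integralZl_EFin//; last exact/measurable_EFinP/measurable_indic.
by rewrite integral_indic// setIT.
Qed.

Variables (mu : probability (mxB R n p) R) (f0 : mxB R n p -> R).
Hypothesis f0_ge0 : forall x, 0 <= f0 x.
Hypothesis mf0 : measurable_fun setT f0.
Hypothesis hXlaw : forall i (A : set (mxB R n p)), measurable A ->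
  P (X i @^-1` A) = (\int[mu]_(x in A) (f0 x)%:E)%E.

Import HBNNSimple.

(** Simple functions increasing to [q] reduce the claim to step functions, where each factor has
    mean at most [r]; monotone convergence passes to the limit of the products. *)
Lemma iid_prod_integral_le (q : mxB R n p -> R) (r : R) N :
  (forall x, 0 <= q x) -> measurable_fun setT q ->
  (\int[mu]_x (q x * f0 x)%:E <= r%:E)%E ->
  (\int[P]_w (\prod_(j < N) q (X j w))%:E <= (r ^+ N)%:E)%E.
Proof.
move=> q0 mq qr.
have mqE : measurable_fun setT (EFin \o q) by exact/measurable_EFinP.
pose g := nnsfun_approx measurableT mqE.
have gq x : (g ^~ x) k @[k --> \oo] --> q x.
  have H : EFin \o g ^~ x @ \oo --> (EFin \o q) x.
    by apply: cvg_nnsfun_approx => // y _; rewrite lee_fin.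
  exact: (fine_cvg H).
have gnd x : nondecreasing_seq (g ^~ x).
  by move=> k l kl; exact/lefP/(nd_nnsfun_approx measurableT mqE).
have gle k x : g k x <= q x.
  by rewrite -(cvg_lim _ (gq x))//; apply: nondecreasing_cvgn_le => //; apply: cvgP (gq x).
have step k : (\int[P]_w (\prod_(j < N) g k (X j w))%:E <= (r ^+ N)%:E)%E.
  pose s : seq R := fset_set (g k @` setT).
  (* A simple function is the sum of its values times the indicators of its level sets. *)
  have gE x : g k x = \sum_(i < size s) (s`_i * \1_(g k @^-1` [set s`_i]) x) by exact: fimfunEord.
  have s0 (i : 'I_(size s)) : 0 <= s`_i.
    have : s`_i \in fset_set (g k @` setT) by exact: mem_nth.
    by rewrite in_fset_set// => /set_mem[x _ <-]; exact: fun_ge0.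
  have mE (i : 'I_(size s)) : measurable (g k @^-1` [set s`_i]).
    by rewrite -[X in measurable X]setTI; exact: measurable_funP.
  under eq_integral do under eq_bigr do rewrite gE.
  rewrite (@step_product_integral _ (fun i : 'I_(size s) => s`_i)
    (fun i : 'I_(size s) => g k @^-1` [set s`_i]))// lee_fin -[in leRHS](card_ord N) -prodr_const.
  apply: ler_prod => j _; apply/andP; split.
    by apply: sumr_ge0 => i _; rewrite mulr_ge0// fine_ge0.
  rewrite -lee_fin; apply: le_trans qr.
  apply: (@le_trans _ _ (\int[mu]_x (g k x * f0 x)%:E)%E); last first.
    by apply: le_integral_nonneg => x _; rewrite lee_fin ?mulr_ge0 ?ler_wpM2r//; exact: fun_ge0.
  rewrite -sumEFin.
  under [leRHS]eq_integral do rewrite gE mulr_suml -sumEFin.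
  rewrite ge0_integral_sum//; first last.
  - by move=> i x _; rewrite lee_fin !mulr_ge0.
  - move=> i; apply/measurable_EFinP; apply: measurable_funM => //.
    by apply: measurable_funM => //; exact: measurable_indic.
  apply: lee_sum => i _.
  under eq_integral do rewrite -mulrA EFinM.
  rewrite ge0_integralZl_EFin//; first last.
  - by apply/measurable_EFinP; apply: measurable_funM => //; exact: measurable_indic.
  - by move=> x _; rewrite lee_fin mulr_ge0.
  rewrite EFinM fineK ?fin_num_measure//; last first.
    by rewrite -[X in measurable X]setTI; exact: hXmeas.
  rewrite hXlaw//; apply: lee_wpmul2l; first by rewrite lee_fin.
  rewrite [leLHS]integral_mkcond.
  rewrite le_eqVlt; apply/orP; left; apply/eqP; apply: eq_integral => x _.
  by rewrite patchE indicE; case: ifPn; rewrite ?mul1r ?mul0r.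
pose G k w := (\prod_(j < N) g k (X j w))%:E : \bar R.
have Gcvg w : G k w @[k --> \oo] --> (\prod_(j < N) q (X j w))%:E.
  apply: cvg_EFin; first exact: nearW.
  by apply: cvg_big => [|j _]; [exact: mul_continuous|exact: gq].
have G0 k w : (0 <= G k w)%E by rewrite lee_fin; apply: prodr_ge0 => j _; exact: fun_ge0.
have mG k : measurable_fun setT (G k).
  apply/measurable_EFinP; apply: measurable_prod => j _.
  exact: (measurableT_comp _ (hXmeas j)).
have Gnd w : nondecreasing_seq (G ^~ w).
  move=> k l kl; rewrite lee_fin; apply: ler_prod => j _.
  by rewrite fun_ge0/=; exact: gnd.
have := @cvg_monotone_convergence _ _ _ P setT measurableT G mG
  (fun k w _ => G0 k w) (fun w _ => Gnd w).
under eq_integral do rewrite (cvg_lim _ (Gcvg _))//.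
move=> H; rewrite -(cvg_lim _ H)//; apply: lime_le; first exact: cvgP H.
exact: nearW.
Qed.

End Probability.

(** * Exponential tilting *)

Section Tilting.
Variable R : realType.

(** From exp(-x) >= 1 - x one gets exp(x) <= 1/(1 - x), and (1 - x)(1 + x + 2 x^2) = 1 + x^2 (1 - 2
    x) is at least 1 when x <= 1/2. *)
Lemma expR_le_quadratic (x : R) : `|x| <= 2^-1 -> expR x <= 1 + x + 2 * x ^+ 2.
Proof.
rewrite ler_norml => /andP[x1 x2].
have x10 : 0 < 1 - x by lra.
have := expR_ge1Dx (- x); rewrite expRN => H.
have : expR x <= (1 - x)^-1.
  by rewrite -[leLHS]invrK lef_pV2 ?posrE ?invr_gt0 ?expR_gt0.
move=> /le_trans; apply.
by rewrite -[leLHS]mul1r ler_pdivrMr//; nra.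
Qed.

Variables (n p : nat) (mu : probability (mxB R n p) R).
Hypothesis hmu : is_haar_stiefel R n p mu.
Local Notation St := (Stiefel R n p : set (mxB R n p)).

(** The quadratic bound on the exponential gives at most 1 - l e + 2 l^2 B^2. The condition 4 l B^2
    <= e makes the last term at most l e / 2, and 1 - l e / 2 <= exp(- l e / 2). *)
Lemma tilted_mass_le (f u : mxB R n p -> R) (K B e l : R) :
  measurable_fun St f -> measurable_fun St u ->
  (forall x, St x -> 0 <= f x <= K) -> (forall x, St x -> `|u x| <= B) ->
  Rintegral mu St f = 1 -> e <= Rintegral mu St (fun x => u x * f x) ->
  0 < l -> l * B <= 2^-1 -> 4 * l * B ^+ 2 <= e ->
  Rintegral mu St (fun x => f x * expR (- (l * u x))) <= expR (- (l * e / 2)).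
Proof.
move=> mf mU fK uB f1 ue l0 lB lBe.
have mSt : measurable St by exact: measurable_Stiefel.
have fi : mu.-integrable St (EFin \o f).
  apply: (Stiefel_integrable mu (B := K)) => // x Sx.
  by case/andP: (fK x Sx) => f0 ?; rewrite ger0_norm.
have ufi : mu.-integrable St (EFin \o (fun x => u x * f x)).
  apply: (Stiefel_integrable mu (B := B * K)) => [|x Sx]; first exact: measurable_funM.
  case/andP: (fK x Sx) => f0 fK'; rewrite normrM (ger0_norm f0).
  by apply: ler_pM => //; exact: uB.
have lux x : St x -> `|- (l * u x)| <= 2^-1.
  by move=> Sx; rewrite normrN normrM gtr0_norm// (le_trans _ lB)// ler_pM2l// uB.
have H1 : Rintegral mu St (fun x => f x * expR (- (l * u x))) <=
    Rintegral mu St (fun x => (1 + 2 * l ^+ 2 * B ^+ 2) * f x - l * (u x * f x)).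
  apply: le_Rintegral => //.
  - apply: (Stiefel_integrable mu (B := K * expR 2^-1)) => [|x Sx].
      apply: measurable_funM => //; apply: measurableT_comp => //.
      by apply: measurableT_comp => //; exact: measurable_funM.
    case/andP: (fK x Sx) => f0 fK'; rewrite normrM (ger0_norm f0) (ger0_norm (expR_ge0 _)).
    apply: ler_pM => //.
    by rewrite ler_expR (le_trans (ler_norm _))// lux.
  - have -> : EFin \o (fun x => (1 + 2 * l ^+ 2 * B ^+ 2) * f x - l * (u x * f x)) =
        ((fun x => ((1 + 2 * l ^+ 2 * B ^+ 2) * f x)%:E) \- (fun x => (l * (u x * f x))%:E))%E.
      by apply/funext => x /=; rewrite EFinB.
    by apply: integrableB => //; [exact: (integrableZl _ (1 + 2 * l ^+ 2 * B ^+ 2) fi)|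
       exact: (integrableZl _ l ufi)].
  - move=> x Sx; case/andP: (fK x Sx) => f0 fK'.
    have H := expR_le_quadratic (lux x Sx).
    have uB2 : u x ^+ 2 <= B ^+ 2.
      by rewrite -[leLHS]real_normK ?num_real// lerXn2r ?nnegrE ?(le_trans _ (uB x Sx))// uB.
    apply: (le_trans (ler_wpM2l f0 H)).
    have -> : f x * (1 + - (l * u x) + 2 * (- (l * u x)) ^+ 2) =
      (1 + 2 * l ^+ 2 * u x ^+ 2) * f x - l * (u x * f x) by ring.
    rewrite lerD2r ler_wpM2r// lerD2l ler_wpM2l//.
    by rewrite mulr_ge0 ?sqr_ge0.
apply: (le_trans H1); rewrite RintegralB//; first last.
- exact: (integrableZl _ l ufi).
- exact: (integrableZl _ (1 + 2 * l ^+ 2 * B ^+ 2) fi).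
rewrite !RintegralZl// f1 mulr1.
apply: le_trans (expR_ge1Dx _).
have := ler_wpM2l (ltW l0) ue.
have := ler_wpM2l (ltW l0) lBe.
by move: (Rintegral _ _ _) => I; nra.
Qed.

End Tilting.

(** * Mixture densities *)

Section Mixture.
Variables (R : realType) (n p C : nat) (mu : probability (mxB R n p) R).
Hypothesis hmu : is_haar_stiefel R n p mu.
Hypothesis hpn : (p <= n)%N.
Local Notation St := (Stiefel R n p : set (mxB R n p)).

Lemma F01_gt0 v : 0 < F01 R n p mu v.
Proof. by rewrite F01E; exact: etr_mean_gt0. Qed.

Lemma fML_gt0 M v V X : 0 < fML R n p mu M v V X.
Proof. by rewrite divr_gt0 ?F01_gt0// expR_gt0. Qed.

Lemma fML_le M v V X : Stiefel R n p X ->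
  fML R n p mu M v V X <= expR (l1norm (V *m diagp R p v *m M^T)) / F01 R n p mu v.
Proof.
move=> HX; rewrite /fML ler_pM2r ?invr_gt0 ?F01_gt0//.
by case/andP: (etr_bounds (V *m diagp R p v *m M^T) HX).
Qed.

Lemma measurable_F01 d (S : measurableType d) (v : S -> nat -> R) :
  (forall j, measurable_fun setT (fun s => v s j)) ->
  measurable_fun setT (fun s => F01 R n p mu (v s)).
Proof.
move=> mv; under eq_fun do rewrite F01E.
apply: measurable_Rintegral_param; first exact: measurable_Stiefel.
apply: measurable_etr; apply: entrywise_mulmx; last first.
  by move=> i j; exact: (measurableT_comp (measurable_mx_entry i j)).
apply: entrywise_mulmx; last exact: entrywise_cst.
apply: entrywise_diagp => j; exact: (measurableT_comp (mv j)).
Qed.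

Definition param_measurable d (S : measurableType d) (th : S -> param R n p) :=
  [/\ forall c, entrywise_measurable (fun s => pM (th s) c),
      forall c j, measurable_fun setT (fun s => pd (th s) c j),
      forall c, entrywise_measurable (fun s => pV (th s) c) &
      forall c, measurable_fun setT (fun s => ppi (th s) c)].

Lemma measurable_fmix d (S : measurableType d) (th : S -> param R n p) (X : S -> mxB R n p) :
  param_measurable th -> entrywise_measurable (X : S -> 'M[R]_(n, p)) ->
  measurable_fun setT (fun s => fmix R n p C mu (th s) (X s)).
Proof.
move=> [mM md mV mpi] mX; apply: measurable_sum => c; apply: measurable_funM => //.
apply: measurable_funM; last first.
  by apply: measurable_invr_ge0 => [s|]; [exact/ltW/F01_gt0|exact: measurable_F01].
apply: measurable_etr; apply: entrywise_mulmx => //.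
apply: entrywise_mulmx; last exact: entrywise_trmx.
by apply: entrywise_mulmx => //; exact: entrywise_diagp.
Qed.

Lemma param_measurable_comp d (S : measurableType d) d' (S' : measurableType d')
    (th : S -> param R n p) (f : S' -> S) : param_measurable th -> measurable_fun setT f ->
  param_measurable (th \o f).
Proof.
move=> [mM md mV mpi] mf; split.
- by move=> c i j; exact: (measurableT_comp (mM c i j) mf).
- by move=> c j; exact: (measurableT_comp (md c j) mf).
- by move=> c i j; exact: (measurableT_comp (mV c i j) mf).
- by move=> c; exact: (measurableT_comp (mpi c) mf).
Qed.

Lemma measurable_fmix1 (th : param R n p) :
  measurable_fun setT (fmix R n p C mu th : mxB R n p -> R).
Proof.
apply: (measurable_fmix (th := fun=> th)); last exact: entrywise_id.
by split=> *; [exact: entrywise_cst|exact: measurable_cst|exact: entrywise_cst|exact: measurable_cst].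
Qed.

Variable th : param R n p.
Hypothesis hth : inXi R n p C th.

Lemma fmix_gt0 X : (0 < C)%N -> 0 < fmix R n p C mu th X.
Proof.
case: C hth => // C' [_ [pi0 _]] _; rewrite /fmix big_ord_recl ltr_wpDr//.
  by apply: sumr_ge0 => c _; rewrite mulr_ge0 ?(ltW (fML_gt0 _ _ _ _))// ltW// pi0.
by rewrite mulr_gt0 ?fML_gt0// pi0.
Qed.

Lemma fmix_bounded : exists K, forall X, Stiefel R n p X -> 0 <= fmix R n p C mu th X <= K.
Proof.
exists (\sum_(c < C) ppi th c * (expR (l1norm (pV th c *m diagp R p (pd th c) *m (pM th c)^T))
  / F01 R n p mu (pd th c))) => X HX; apply/andP; split.
  by apply: sumr_ge0 => c _; rewrite mulr_ge0 ?(ltW (fML_gt0 _ _ _ _))// ltW// hth.2.1.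
by apply: ler_sum => c _; rewrite ler_pM2l ?hth.2.1// fML_le.
Qed.

Lemma fmix_Rintegral : Rintegral mu St (fmix R n p C mu th) = 1.
Proof.
have mSt : measurable St by exact: measurable_Stiefel.
rewrite -hth.2.2 /fmix.
have fi c (cC : (c < C)%N) : mu.-integrable St
    (EFin \o (fun X : mxB R n p => ppi th c * fML R n p mu (pM th c) (pd th c) (pV th c) X)).
  pose K := ppi th c * (expR (l1norm (pV th c *m diagp R p (pd th c) *m (pM th c)^T))
    / F01 R n p mu (pd th c)).
  apply: (Stiefel_integrable mu (B := K)) => [|X HX]; last first.
    rewrite ger0_norm; first by rewrite ler_pM2l ?hth.2.1// fML_le.
    by rewrite mulr_ge0 ?(ltW (fML_gt0 _ _ _ _))// ltW// hth.2.1.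
  apply: measurable_funTS; apply: measurable_funM => //; apply: measurable_funM => //.
  apply: measurable_etr; apply: entrywise_mulmx; [exact: entrywise_cst|exact: entrywise_id].
rewrite /Rintegral; under eq_integral do rewrite -sumEFin.
rewrite ge0_integral_sum//; first last.
- by move=> c X _; rewrite lee_fin mulr_ge0 ?(ltW (fML_gt0 _ _ _ _))// ltW// hth.2.1.
- by move=> c; apply: (measurable_int _ (fi _ (ltn_ord c))).
rewrite -sum_fine; last by move=> c _; exact: (integrable_fin_num mSt (fi _ (ltn_ord c))).
apply: eq_bigr => c _; rewrite -/(Rintegral _ _ _) RintegralZl//; last first.
  have := integrableZl mSt (ppi th c)^-1 (fi _ (ltn_ord c)).
  congr (integrable _ _ _); apply/funext => X /=.
  by rewrite -EFinM mulKf// gt_eqF// hth.2.1.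
by rewrite fML_integral ?mulr1//; have [[? _] [_ ?]] := hth.1 c (ltn_ord c).
Qed.

End Mixture.

(** * The prior *)

Section Closeness.
Variables (R : realType) (n p C : nat) (mu : probability (mxB R n p) R).
Hypothesis hmu : is_haar_stiefel R n p mu.
Hypothesis hpn : (p <= n)%N.

Lemma l1norm_le m k (A : 'M[R]_(m, k)) (e : R) : (forall i j, `|A i j| <= e) ->
  l1norm A <= (m * k)%:R * e.
Proof.
move=> Ae; apply: (@le_trans _ _ (\sum_(i < m) \sum_(j < k) e)).
  by apply: ler_sum => i _; apply: ler_sum => j _.
by rewrite !sumr_const !card_ord -mulrnA mulr_natl mulnC.
Qed.

Lemma mulmx_diagpE (V : 'M[R]_p) v (M : 'M[R]_(n, p)) i j :
  (V *m diagp R p v *m M^T) i j = \sum_(k < p) V i k * v k * M j k.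
Proof.
rewrite mxE; apply: eq_bigr => k _; rewrite !mxE (bigD1 k)//= mxE eqxx big1 ?addr0//.
by move=> l lk; rewrite mxE (negbTE lk) mulr0.
Qed.

(** The matrix V D M^T has p n entries, each a sum of [p] triple products. Changing one factor at a
    time costs at most (D + 1) r for [V], r for the diagonal and D r for [M], where D + 1 bounds the
    perturbed diagonal because r <= 1. *)
Definition lipschitz_cst (D : R) : R := (p * n)%:R * (p%:R * (2 * D + 2)).

Lemma lipschitz_cst_ge0 (D : R) : 0 <= D -> 0 <= lipschitz_cst D.
Proof. by move=> D0; rewrite !mulr_ge0// addr_ge0// mulr_ge0. Qed.

Lemma l1norm_frame_le (V V0 : 'M[R]_p) (v v0 : nat -> R) (M M0 : 'M[R]_(n, p)) (D r : R) :
  Stiefel R p p V -> Stiefel R p p V0 -> Stiefel R n p M -> Stiefel R n p M0 ->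
  0 <= r <= 1 ->
  (forall k, (k < p)%N -> `|v0 k| <= D) -> (forall k, (k < p)%N -> `|v k - v0 k| <= r) ->
  (forall i j, `|V i j - V0 i j| <= r) -> (forall i j, `|M i j - M0 i j| <= r) ->
  l1norm (V *m diagp R p v *m M^T - V0 *m diagp R p v0 *m M0^T) <= lipschitz_cst D * r.
Proof.
move=> HV HV0 HM HM0 /andP[r0 r1] v0D vv VV MM.
rewrite -mulrA; apply: l1norm_le => i j.
rewrite mxE [X in _ + X]mxE !mulmx_diagpE -sumrB -mulrA -[leRHS]/(_ * _).
apply: (le_trans (ler_norm_sum _ _ _)).
rewrite mulr_natl -[p in leRHS]card_ord -sumr_const; apply: ler_sum => k _.
have hV := Stiefel_entry_le1 i k HV; have hV0 := Stiefel_entry_le1 i k HV0.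
have hM := Stiefel_entry_le1 j k HM; have hM0 := Stiefel_entry_le1 j k HM0.
have hD := v0D k (ltn_ord k); have hv := vv k (ltn_ord k).
have D0 : 0 <= D := le_trans (normr_ge0 _) hD.
have -> : V i k * v k * M j k - V0 i k * v0 k * M0 j k =
    (V i k - V0 i k) * (v k * M j k) + V0 i k * ((v k - v0 k) * M j k) +
    V0 i k * (v0 k * (M j k - M0 j k)) by ring.
have hvD : `|v k| <= D + 1.
  have -> : v k = v0 k + (v k - v0 k) by ring.
  by apply: (le_trans (ler_normD _ _)); rewrite lerD// (le_trans hv).
have -> : (2 * D + 2) * r = r * ((D + 1) * 1) + 1 * (r * 1) + 1 * (D * r) by ring.
apply: (le_trans (ler_normD _ _)); apply: lerD.
  apply: (le_trans (ler_normD _ _)); apply: lerD; rewrite !normrM.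
    by rewrite ler_pM ?mulr_ge0// ?VV// ler_pM.
  by rewrite ler_pM ?mulr_ge0// ler_pM.
by rewrite !normrM ler_pM ?mulr_ge0// ler_pM.
Qed.

Lemma Stiefel1 k : Stiefel R k k 1%:M.
Proof. by rewrite /Stiefel/= trmx1 mulmx1. Qed.

Lemma F01_close (v v0 : nat -> R) (D r : R) : 0 <= r <= 1 ->
  (forall k, (k < p)%N -> `|v0 k| <= D) -> (forall k, (k < p)%N -> `|v k - v0 k| <= r) ->
  F01 R n p mu v <= expR (lipschitz_cst D * r) * F01 R n p mu v0.
Proof.
move=> r01 v0D vv; rewrite !F01E.
apply: (le_trans (@etr_mean_le R n p mu (diagp R p v0 *m (id_frame R n p)^T) _)); rewrite ler_pM2r ?etr_mean_gt0// ler_expR.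
have := @l1norm_frame_le 1%:M 1%:M v v0 (id_frame R n p) (id_frame R n p) D r.
rewrite !mul1mx; apply => //; try exact: Stiefel1; try exact: id_frame_Stiefel.
  by move=> i j; rewrite subrr normr0; case/andP: r01.
by move=> i j; rewrite subrr normr0; case/andP: r01.
Qed.

(** The factor 2 in the exponent: the numerator and the normalizing constant each lose at most
    exp(L). *)
Lemma fML_close (V V0 : 'M[R]_p) (v v0 : nat -> R) (M M0 X : 'M[R]_(n, p)) (D r : R) :
  Stiefel R p p V -> Stiefel R p p V0 -> Stiefel R n p M -> Stiefel R n p M0 ->
  Stiefel R n p X -> 0 <= r <= 1 ->
  (forall k, (k < p)%N -> `|v0 k| <= D) -> (forall k, (k < p)%N -> `|v k - v0 k| <= r) ->
  (forall i j, `|V i j - V0 i j| <= r) -> (forall i j, `|M i j - M0 i j| <= r) ->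
  fML R n p mu M0 v0 V0 X <= expR (2 * (lipschitz_cst D * r)) * fML R n p mu M v V X.
Proof.
move=> HV HV0 HM HM0 HX r01 v0D vv VV MM.
have HF := F01_close r01 v0D vv.
have HA := l1norm_frame_le HV HV0 HM HM0 r01 v0D vv VV MM.
set L := lipschitz_cst D * r in HF HA *.
have F0 := F01_gt0 hmu v; have F00 := F01_gt0 hmu v0.
rewrite /fML ler_pdivrMr//.
have He : etr R p (V0 *m diagp R p v0 *m M0^T *m X) <=
    expR L * etr R p (V *m diagp R p v *m M^T *m X).
  rewrite /etr -expRD ler_expR -lerBlDr -linearB/= -mulmxBl.
  apply: (le_trans (ler_norm _)); rewrite -opprB mulNmx linearN normrN.
  exact: (le_trans (mxtrace_le_l1norm _ HX)).
apply: (le_trans He); rewrite (_ : 2 * L = L + L) ?expRD; last by ring.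
have -> : expR L * expR L * (etr R p (V *m diagp R p v *m M^T *m X) / F01 R n p mu v) * F01 R n p mu v0
  = expR L * etr R p (V *m diagp R p v *m M^T *m X) *
    (expR L * F01 R n p mu v0 / F01 R n p mu v) by ring.
rewrite ler_peMr ?mulr_ge0 ?expR_ge0//.
rewrite ler_pdivlMr; last exact: F0.
by rewrite mul1r; exact: HF.
Qed.

Variable th0 : param R n p.
Hypothesis hth0 : inXi R n p C th0.

Definition param_close (delta : R) (th : param R n p) := forall X, Stiefel R n p X ->
  fmix R n p C mu th0 X <= expR delta * fmix R n p C mu th X.

Lemma fmix_close (th : param R n p) (D r delta : R) : inXi R n p C th -> 0 <= r <= 1 ->
  2 * (lipschitz_cst D * r) <= delta / 2 ->
  (forall c, (c < C)%N -> [/\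
    (forall k, (k < p)%N -> `|pd th0 c k| <= D),
    (forall k, (k < p)%N -> `|pd th c k - pd th0 c k| <= r),
    (forall i j, `|pV th c i j - pV th0 c i j| <= r),
    (forall i j, `|pM th c i j - pM th0 c i j| <= r) &
    ppi th0 c <= expR (delta / 2) * ppi th c]) ->
  param_close delta th.
Proof.
move=> hth r01 Lr H X HX; rewrite /fmix mulr_sumr; apply: ler_sum => c _.
have [H1 H2 H3 H4 H5] := H c (ltn_ord c).
have [[HM _] [_ HV]] := hth.1 c (ltn_ord c).
have [[HM0 _] [_ HV0]] := hth0.1 c (ltn_ord c).
have pi0 := hth0.2.1 c (ltn_ord c).
have HfML := fML_close HV HV0 HM HM0 HX r01 H1 H2 H3 H4.
(* Half of [delta] pays for the mixture weight, the other half for the Langevin density. *)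
rewrite {1}(splitr delta) expRD.
have -> : expR (delta / 2) * expR (delta / 2) * (ppi th c * fML R n p mu (pM th c) (pd th c) (pV th c) X)
  = (expR (delta / 2) * ppi th c) * (expR (delta / 2) * fML R n p mu (pM th c) (pd th c) (pV th c) X).
  by ring.
apply: ler_pM => //; [exact: ltW|exact/ltW/fML_gt0|apply: (le_trans HfML)].
by rewrite ler_wpM2r ?ler_expR//; exact/ltW/fML_gt0.
Qed.

Lemma RN_ge0 (th : param R n p) (x : nat -> 'M[R]_(n, p)) N : (0 < C)%N ->
  inXi R n p C th -> 0 <= RN R n p C mu th0 th x N.
Proof.
move=> C0 hth; apply: prodr_ge0 => i _.
by rewrite divr_ge0 ?ltW// fmix_gt0.
Qed.

(** Deterministic in the sample: each of the [N] ratios is at least exp(-delta) as soon as the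
    observations lie on the manifold. *)
Lemma RN_ge (th : param R n p) (x : nat -> 'M[R]_(n, p)) N delta : (0 < C)%N ->
  (forall i, Stiefel R n p (x i)) -> param_close delta th ->
  expR (- delta) ^+ N <= RN R n p C mu th0 th x N.
Proof.
move=> C0 hx hth; rewrite -[in leLHS](card_ord N) -prodr_const; apply: ler_prod => i _.
rewrite expR_ge0/= ler_pdivlMr ?fmix_gt0// expRN ler_pdivrMl ?expR_gt0//.
exact: hth.
Qed.

End Closeness.

(** * The layers of the prior *)

Section LangevinLayer.
Local Open Scope ereal_scope.
Variables (R : realType) (n p : nat) (mu : probability (mxB R n p) R).
Hypothesis hmu : is_haar_stiefel R n p mu.
Variables (D : set (mxB R n p)) (G : 'M[R]_(n, p)).
Hypothesis mD : measurable D.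
Hypothesis DS : D `<=` Stiefel R n p.

(** With [D] the set [StiefelTilde] this is [densM], with [D] the square Stiefel manifold it is
    [densV]; one treatment covers both layers. *)
Definition langevin_dens (X : 'M[R]_(n, p)) : R :=
  (etr R p (G^T *m X) / Rintegral mu D (fun Y : mxB R n p => etr R p (G^T *m Y)))%R.

Definition langevinI (g : 'M[R]_(n, p) -> \bar R) : \bar R :=
  \int[mu]_(X in D) (g X * (langevin_dens X)%:E).

Lemma langevin_dens_ge0 X : (0 <= langevin_dens X)%R.
Proof. by rewrite divr_ge0 ?expR_ge0//; apply: Rintegral_ge0 => Y _; exact: expR_ge0. Qed.

Lemma measurable_langevin_dens : measurable_fun setT (langevin_dens : mxB R n p -> R).
Proof.
apply: measurable_funM => //; apply: measurable_etr.
by apply: entrywise_mulmx; [exact: entrywise_cst|exact: entrywise_id].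
Qed.

Lemma langevinI_pfun (M : 'M[R]_(n, p)) (r : R) : Stiefel R n p M -> (0 < r)%R ->
  (forall X, Stiefel R n p X -> mx_box M r X -> D X) ->
  pfun D (mx_box M r) langevinI.
Proof.
move=> HM r0 BD; split.
- by move=> f f0; apply: integral_ge0 => X DX; rewrite mule_ge0 ?f0// lee_fin langevin_dens_ge0.
- move=> f g f0 fg; apply: le_integral_nonneg => X DX.
    by rewrite mule_ge0 ?f0// lee_fin langevin_dens_ge0.
  by rewrite lee_wpmul2r ?fg// lee_fin langevin_dens_ge0.
- by apply: integral0_eq => X _; rewrite mul0e.
set Z := Rintegral mu D (fun Y : mxB R n p => etr R p (G^T *m Y)).
(* Division by a zero constant yields the zero density, and the functional is null. *)
have [Z0|Z0] := eqVneq Z 0%R.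
  left=> f; apply: integral0_eq => X _.
  by rewrite /langevin_dens -/Z Z0 invr0 mulr0 mule0.
have {}Z0 : (0 < Z)%R by rewrite lt0r Z0; apply: Rintegral_ge0 => Y _; exact: expR_ge0.
(* The box meets the complement of the manifold in a null set, so [A] keeps the positive mass of the
   box; on [A] the density is at least [k]. *)
right; set A : set (mxB R n p) := mx_box M r `&` Stiefel R n p.
have mS := @measurable_Stiefel R n p; have mB := @measurable_mx_box R n p M r.
have mA : measurable A by exact: measurableI.
have A0 : (0 < fine (mu A))%R.
  rewrite fine_gt0// (le_lt_trans (probability_le1 mu mA)) ?ltry// andbT.
  rewrite lt0e measure_ge0 andbT; apply/negP => /eqP muA.
  have := haar_mx_box_gt0 hmu HM r0; rewrite lt0e => /andP[/eqP + _]; apply.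
  apply/(negligibleP mu mB).
  apply: (@negligibleS _ _ _ _ (A `|` ~` (Stiefel R n p : set (mxB R n p)))).
    by move=> X BX; have [SX|] := pselect (Stiefel R n p X); [left|right].
  apply: negligibleU; first exact/(negligibleP mu mA).
  by apply/(negligibleP mu (measurableC mS)); exact: haar_setCStiefel.
set k := (expR (- l1norm (G^T)) / Z)%R.
have k0 : (0 < k)%R by rewrite divr_gt0 ?expR_gt0.
exists (k * fine (mu A))%R; first exact: mulr_gt0.
move=> f c c0 f0 fc; rewrite /langevinI integral_mkcond.
have ck : (0 <= c * k)%R by rewrite mulr_ge0// ltW.
apply: (@le_trans _ _ (\int[mu]_X ((c * k)%:E * (\1_A X)%:E))).
  rewrite ge0_integralZl_EFin//; last exact/measurable_EFinP/measurable_indic.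
  rewrite integral_indic// setIT mulrA EFinM fineK//.
  by rewrite ge0_fin_numE// (le_lt_trans (probability_le1 mu mA)) ?ltry.
apply: le_integral_nonneg => X _.
  by rewrite mule_ge0// lee_fin.
rewrite indicE; case: (boolP (X \in A)) => [/set_mem[BX SX]|_]; last first.
  rewrite mule0 patchE; case: ifPn => // /set_mem DX.
  by rewrite mule_ge0 ?f0// lee_fin langevin_dens_ge0.
have DX : D X by exact: BD.
rewrite mule1 patchE mem_set// EFinM.
apply: lee_pmul; rewrite ?lee_fin ?(ltW k0) ?fc//.
rewrite ler_pM2r ?invr_gt0//.
by case/andP: (etr_bounds (G^T) SX).
Qed.

Definition mx_coord (ij : 'I_n * 'I_p) (X : 'M[R]_(n, p)) : R := X ij.1 ij.2.

Lemma langevinI_repr : repr mx_coord D langevinI.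
Proof.
apply: (@Repr R _ _ mx_coord D langevinI _ (mxB R n p) mu (fun X : mxB R n p => (X : 'M[R]_(n, p)))
  (fun X => (\1_D X * langevin_dens X)%R)).
- by move=> ij; exact: measurable_mx_entry.
- by apply: measurable_funM; [exact: measurable_indic|exact: measurable_langevin_dens].
- by move=> X; rewrite mulr_ge0// langevin_dens_ge0.
- move=> X; rewrite mulf_eq0 negb_or indicE => /andP[+ _].
  by case: (boolP (X \in D)) => [/set_mem//|]; rewrite eqxx.
- move=> F F0 mF; rewrite /langevinI integral_mkcond; apply: eq_integral => X _.
  rewrite patchE indicE; case: ifPn => _; first by rewrite mul1r.
  by rewrite mul0r mule0.
Qed.

(** The mass is 1, or 0 when the normalizing constant is 0; the upper bound covers both. *)
Lemma langevinI_mass : langevinI (fun=> 1) <= 1.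
Proof.
have mS := @measurable_Stiefel R n p.
have iG : mu.-integrable D (EFin \o (fun Y : mxB R n p => etr R p (G^T *m Y))).
  exact: (integrableS mS mD DS (etr_integrable mu (G^T))).
have E : langevinI (fun=> 1) = (Rintegral mu D langevin_dens)%:E.
  rewrite /langevinI; under eq_integral do rewrite mul1e.
  rewrite /Rintegral fineK//; apply: integrable_fin_num => //.
  have := integrableZr mD (Rintegral mu D (fun Y : mxB R n p => etr R p (G^T *m Y)))^-1 iG.
  by apply: eq_integrable => // X _; rewrite /= -EFinM.
rewrite E lee_fin /langevin_dens RintegralZr//.
set Z := Rintegral _ _ _; have [->|Z0] := eqVneq Z 0%R; first by rewrite mul0r.
by rewrite divff.
Qed.

End LangevinLayer.

Section LebesgueLayer.
Local Open Scope ereal_scope.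
Variables (R : realType) (k : nat) (u : (nat -> R) -> R) (P : (nat -> R) -> Prop).
Hypothesis u_ge0 : forall y, (0 <= u y)%R.
Hypothesis uP : forall y, u y != 0%R -> P y.
Hypothesis u_meas : forall d (S : measurableType d) (f : S -> nat -> R),
  (forall j, measurable_fun setT (fun s => f s j)) -> measurable_fun setT (fun s => u (f s)).

Let Z : R := fine (lebInt R k (fun y => (u y)%:E)).

(** Serves both the layer of the d_c, with [undensd], and the Dirichlet layer, with [undensDir] in C
    - 1 coordinates. *)
Definition lebdensI (g : (nat -> R) -> \bar R) : \bar R :=
  lebInt R k (fun y => g y * (u y / Z)%:E).

Let lebInt_ge0 (f : (nat -> R) -> \bar R) : (forall y, 0 <= f y) -> 0 <= lebInt R k f.
Proof.
move=> f0.
by apply: (pfun_ge0 (@lebInt_pfun R k (fun=> 0%R) (fun=> 1%R) (fun _ _ => ltr01))) => y _.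
Qed.

Let Z_ge0 : (0 <= Z)%R.
Proof. by rewrite fine_ge0// lebInt_ge0// => y; rewrite lee_fin. Qed.

Lemma lebdensI_repr : repr (fun i (y : nat -> R) => y i) P lebdensI.
Proof.
apply: (weight_repr (v := fun y => (u y / Z)%R) (lebInt_repr R k)).
- by move=> y; rewrite divr_ge0.
- by move=> d S f mf; apply: measurable_funM => //; exact: u_meas.
- by move=> y; rewrite mulf_eq0 negb_or => /andP[/uP].
Qed.

Lemma lebdensI_pfun (a b : nat -> R) (e : R) :
  (forall j, (j < k)%N -> (a j < b j)%R) -> (0 < e)%R ->
  (forall y, (forall j, (j < k)%N -> (a j < y j < b j)%R) -> (e <= u y)%R) ->
  pfun P (fun y => forall j, (j < k)%N -> (a j < y j < b j)%R) lebdensI.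
Proof.
move=> ab e0 eu; apply: (weight_pfun (v := fun y => (u y / Z)%R) (lebInt_pfun ab)).
- by move=> y; rewrite divr_ge0.
- by move=> y; rewrite mulf_eq0 negb_or => /andP[/uP].
- by move=> y By; apply: uP; rewrite gt_eqF// (lt_le_trans e0)// eu.
- have [->|Z0] := eqVneq Z 0%R; first by left=> y; rewrite invr0 mulr0.
  have {}Z0 : (0 < Z)%R by rewrite lt0r Z0 Z_ge0.
  right; exists (e / Z)%R; first exact: divr_gt0.
  by move=> y By; rewrite ler_pM2r ?invr_gt0// eu.
Qed.

Lemma lebdensI_mass : lebdensI (fun=> 1) <= 1.
Proof.
have [d S m f w mf mw w0 _ E] := lebInt_repr R k.
have uf0 s : 0 <= (u (f s))%:E by rewrite lee_fin.
have muf : measurable_fun setT (fun s => (u (f s))%:E).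
  by apply/measurable_EFinP; exact: u_meas.
have EZ : lebdensI (fun=> 1) = lebInt R k (fun y => (u y)%:E) * (Z^-1)%:E.
  rewrite /lebdensI E; first last.
  - apply: emeasurable_funM => //; apply/measurable_EFinP.
    by apply: measurable_funM => //; exact: u_meas.
  - by move=> s; rewrite mul1e lee_fin divr_ge0.
  rewrite E// -ge0_integralZr//; first last.
  - by rewrite lee_fin invr_ge0.
  - by move=> s _; rewrite mule_ge0// lee_fin.
  - by apply: emeasurable_funM => //; exact/measurable_EFinP.
  by apply: eq_integral => s _; rewrite mul1e EFinM muleAC.
rewrite EZ; have [->|Z0] := eqVneq Z 0%R; first by rewrite invr0 mule0.
(* [fine] sends an infinite integral to 0, so a nonzero [Z] forces finiteness. *)
have Lfin : lebInt R k (fun y => (u y)%:E) \is a fin_num.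
  apply: contra_neqT Z0 => nfin; rewrite /Z.
  by move: nfin; case: (lebInt R k _).
by rewrite -(fineK Lfin) -/Z -EFinM divff.
Qed.

End LebesgueLayer.

Section Boxes.
Variable R : realType.

Lemma pos_lower_bound (f : nat -> R) k : (forall j, (j < k)%N -> 0 < f j) ->
  exists2 r, 0 < r & forall j, (j < k)%N -> r <= f j.
Proof.
elim: k => [|k IH] f0; first by exists 1.
have [r r0 rf] := IH (fun j jk => f0 j (ltnW jk)).
exists (Num.min r (f k)); first by rewrite lt_min r0 f0.
move=> j; rewrite ltnS leq_eqVlt => /orP[/eqP ->|jk]; first by rewrite ge_min lexx orbT.
by rewrite ge_min rf.
Qed.

Lemma pos_lower_bound_fin (I : finType) (f : I -> R) : (forall i, 0 < f i) ->
  exists2 r, 0 < r & forall i, r <= f i.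
Proof.
move=> f0; exists (\big[Num.min/1]_i f i); last by move=> i; exact: bigmin_le.
by apply: lt_bigmin.
Qed.

Lemma measurable_forall_nat d (T : measurableType d) (A : nat -> Prop) (P : nat -> set T) :
  (forall i, measurable (P i)) -> measurable [set x | forall i, A i -> P i x].
Proof.
move=> mP; rewrite (_ : [set _ | _] = \bigcap_(i in [set i | A i]) P i)//.
by apply: bigcap_measurableType.
Qed.

Lemma measurable_lt_set d (T : measurableType d) (f g : T -> R) :
  measurable_fun setT f -> measurable_fun setT g -> measurable [set x | f x < g x].
Proof.
move=> mf mg; have mfg := measurable_fun_ltr mf mg.
rewrite (_ : [set _ | _] = setT `&` (fun x => f x < g x) @^-1` [set true]); last by rewrite setTI.
exact: (mfg measurableT [set true]).
Qed.

(** [Sp] is open: a move below the smallest entry keeps positivity, and a move below half the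
    smallest gap keeps the order. *)
Lemma Sp_box p (d0 : nat -> R) : Sp R p d0 ->
  exists2 r0, 0 < r0 & forall y, (forall j, (j < p)%N -> d0 j - r0 < y j < d0 j + r0) -> Sp R p y.
Proof.
move=> [d00 dd].
have [r1 r10 r1d] := pos_lower_bound d00.
have [r2 r20 r2d] : exists2 r, 0 < r &
    (* The last entry has no successor; 1 is a placeholder for its gap. *)
    forall j, (j < p)%N -> r <= (if (j.+1 < p)%N then d0 j - d0 j.+1 else 1).
  by apply: pos_lower_bound => j _; case: ifPn => // /dd; rewrite subr_gt0.
exists (Num.min r1 (r2 / 2)); first by rewrite lt_min r10 divr_gt0.
move=> y yd; split=> j jp.
  have /andP[+ _] := yd j jp; apply: le_lt_trans.
  by rewrite subr_ge0 ge_min r1d.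
have /andP[h1 _] := yd j (ltnW jp); have /andP[_ h2] := yd _ jp.
have := r2d j (ltnW jp); rewrite jp => h3.
apply: (lt_le_trans h2); apply: (le_trans _ (ltW h1)).
have : Num.min r1 (r2 / 2) <= r2 / 2 by rewrite ge_min lexx orbT.
by lra.
Qed.

End Boxes.

Section PriorDensities.
Variables (R : realType) (n p : nat) (mu : probability (mxB R n p) R).
Hypothesis hmu : is_haar_stiefel R n p mu.
Hypothesis hpn : (p <= n)%N.
Variables (nu : R) (eta : nat -> R).

Lemma undensd_ge0 y : 0 <= undensd R n p mu nu eta y.
Proof. by rewrite /undensd; case: ifPn => // _; rewrite divr_ge0 ?expR_ge0 ?powR_ge0. Qed.

Lemma undensd_supp y : undensd R n p mu nu eta y != 0 -> Sp R p y.
Proof. by rewrite /undensd; case: ifPn => [/asboolP//|_]; rewrite eqxx. Qed.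

Lemma measurable_undensd d (S : measurableType d) (f : S -> nat -> R) :
  (forall j, measurable_fun setT (fun s => f s j)) ->
  measurable_fun setT (fun s => undensd R n p mu nu eta (f s)).
Proof.
move=> mf; pose A := [set s | Sp R p (f s)].
have mA : measurable A.
  apply: (@measurableI _ _ [set s | forall j, (j < p)%N -> 0 < f s j]
    [set s | forall j, (j.+1 < p)%N -> f s j.+1 < f s j]).
    apply: (@measurable_forall_nat _ _ (fun j => (j < p)%N) (fun j => [set s | 0 < f s j])) => j.
    by apply: measurable_lt_set.
  apply: (@measurable_forall_nat _ _ (fun j => (j.+1 < p)%N) (fun j => [set s | f s j.+1 < f s j])) => j.
  by apply: measurable_lt_set.
rewrite (_ : (fun _ => _) = (fun s => \1_A s * (expR (nu * \sum_(j < p) eta j * f s j) *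
   (F01 R n p mu (f s) `^ nu)^-1))).
  apply: measurable_funM; first exact: measurable_indic.
  apply: measurable_funM.
    apply: measurableT_comp => //; apply: measurable_funM => //.
    by apply: measurable_sum => j; exact: measurable_funM.
  apply: measurable_invr_ge0 => [s|]; first exact: powR_ge0.
  by apply: (measurableT_comp (measurable_powR nu)); exact: measurable_F01.
apply/funext => s; rewrite /undensd indicE /A; case: ifPn => [/asboolP H|/asboolP H].
  by rewrite mem_set// mul1r.
by rewrite memNset// mul0r.
Qed.

(** On the box the exponent is at least minus nu times the sum of |eta_j| (|d0_j| + 1), and
    [F01_close] bounds the normalizing constant above by [Fmax]. The radius also stays below [rho],
    the closeness required later. *)
Lemma undensd_box (d0 : nat -> R) (rho : R) : 0 <= nu -> Sp R p d0 -> 0 < rho -> rho <= 1 ->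
  exists r e : R, [/\ 0 < r, r <= rho, 0 < e &
    forall y, (forall j, (j < p)%N -> d0 j - r < y j < d0 j + r) ->
      e <= undensd R n p mu nu eta y].
Proof.
move=> nu0 hd0 rho0 rho1; have [r0 r00 hr0] := Sp_box hd0.
pose r := Num.min r0 rho.
have r_gt0 : 0 < r by rewrite lt_min r00.
have rr0 : r <= r0 by rewrite ge_min lexx.
have rrho : r <= rho by rewrite ge_min lexx orbT.
pose D := \sum_(j < p) `|d0 j|.
have d0D k : (k < p)%N -> `|d0 k| <= D.
  by move=> kp; rewrite /D (bigD1 (Ordinal kp))//= lerDl; exact: sumr_ge0.
pose Fmax := expR (lipschitz_cst n p D * r) * F01 R n p mu d0.
have Fmax0 : 0 < Fmax by rewrite mulr_gt0 ?expR_gt0 ?F01_gt0.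
exists r, (expR (- (nu * \sum_(j < p) `|eta j| * (`|d0 j| + 1))) / Fmax `^ nu); split => //.
  by rewrite divr_gt0 ?expR_gt0 ?powR_gt0.
move=> y yr.
have yabs j : (j < p)%N -> `|y j - d0 j| <= r.
  by move=> /yr /andP[h1 h2]; rewrite ler_norml; apply/andP; split; lra.
have hy : Sp R p y.
  by apply: hr0 => j /yr /andP[h1 h2]; apply/andP; split; lra.
rewrite /undensd; case: ifPn => [_|/asboolP//].
have hF : F01 R n p mu y <= Fmax.
  by apply: F01_close => //; rewrite (ltW r_gt0) (le_trans rrho).
apply: ler_pM; rewrite ?expR_ge0 ?invr_ge0 ?powR_ge0//.
  rewrite ler_expR -mulrN ler_wpM2l// -sumrN; apply: ler_sum => j _.
  have hj : `|eta j * y j| <= `|eta j| * (`|d0 j| + 1).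
    rewrite normrM ler_wpM2l// -[y j](subrK (d0 j)) (le_trans (ler_normD _ _))//.
    by rewrite addrC lerD2l (le_trans (yabs _ (ltn_ord j)))// (le_trans rrho).
  by move: hj; rewrite ler_norml => /andP[].
have F0 := F01_gt0 hmu y.
by rewrite lef_pV2 ?posrE ?powR_gt0// ge0_ler_powR ?nnegrE// ltW.
Qed.

End PriorDensities.

Section Dirichlet.
Variables (R : realType) (C : nat) (alpha : nat -> R).
Hypothesis C0 : (0 < C)%N.

Lemma simplex_ext_sum (w : nat -> R) : \sum_(c < C) simplex_ext R C w c = 1.
Proof.
case: C C0 => // C' _; rewrite big_ord_recr/= {2}/simplex_ext ltnn eqxx.
rewrite (eq_bigr (fun i : 'I_C' => w i)) ?subrKC// => i _.
by rewrite /simplex_ext/= ltn_ord.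
Qed.

Lemma undensDir_ge0 w : 0 <= undensDir R C alpha w.
Proof.
by rewrite /undensDir; case: ifPn => // _; apply: prodr_ge0 => c _; exact: powR_ge0.
Qed.

Lemma undensDir_supp w : undensDir R C alpha w != 0 ->
  forall c, (c < C)%N -> 0 < simplex_ext R C w c.
Proof. by rewrite /undensDir; case: ifPn => [/asboolP//|_]; rewrite eqxx. Qed.

Lemma measurable_simplex_ext d (S : measurableType d) (f : S -> nat -> R) c :
  (forall j, measurable_fun setT (fun s => f s j)) ->
  measurable_fun setT (fun s => simplex_ext R C (f s) c).
Proof.
move=> mf; rewrite /simplex_ext; case: (c < C.-1)%N; first exact: mf.
case: (c == C.-1); last exact: measurable_cst.
by apply: measurable_funB => //; apply: measurable_sum => j.
Qed.

Lemma measurable_undensDir d (S : measurableType d) (f : S -> nat -> R) :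
  (forall j, measurable_fun setT (fun s => f s j)) ->
  measurable_fun setT (fun s => undensDir R C alpha (f s)).
Proof.
move=> mf; pose A := [set s | forall c, (c < C)%N -> 0 < simplex_ext R C (f s) c].
have mA : measurable A.
  apply: (@measurable_forall_nat _ _ (fun c => (c < C)%N) (fun c => [set s | 0 < simplex_ext R C (f s) c])) => c.
  by apply: measurable_lt_set => //; exact: measurable_simplex_ext.
rewrite (_ : (fun _ => _) = (fun s => \1_A s *
   \prod_(c < C) (simplex_ext R C (f s) c `^ (alpha c - 1)))).
  apply: measurable_funM; first exact: measurable_indic.
  apply: measurable_prod => c _.
  by apply: (measurableT_comp (measurable_powR _)); exact: measurable_simplex_ext.
apply/funext => s; rewrite /undensDir indicE /A; case: ifPn => [/asboolP H|/asboolP H].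
  by rewrite mem_set// mul1r.
by rewrite memNset// mul0r.
Qed.

Lemma undensDir_box (pi0 : nat -> R) (delta : R) :
  (forall c, (c < C)%N -> 0 < pi0 c) -> \sum_(c < C) pi0 c = 1 -> 0 < delta ->
  exists r e : R, [/\ 0 < r, 0 < e &
    forall y, (forall j, (j < C.-1)%N -> pi0 j - r < y j < pi0 j + r) ->
      (forall c, (c < C)%N -> pi0 c <= expR delta * simplex_ext R C y c) /\
      e <= undensDir R C alpha y].
Proof.
move=> pi00 pi01 delta0.
have edelta : expR (- delta) < 1 by rewrite -expR0 ltr_expR oppr_lt0.
have [r1 r10 r1pi] : exists2 r, 0 < r & forall c, (c < C)%N -> r <= pi0 c * (1 - expR (- delta)).
  by apply: pos_lower_bound => c cC; rewrite mulr_gt0 ?subr_gt0 ?pi00.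
(* The last weight is 1 minus the others and may move by (C - 1) r = r1 - r, still less than [r1].
   Every weight therefore stays above [a c]. *)
pose r := r1 / C%:R.
have CR : 0 < C%:R :> R by rewrite ltr0n.
have r0 : 0 < r by rewrite divr_gt0.
have Cr : C%:R * r = r1 by rewrite /r mulrC divfK// gt_eqF.
have C1r : (C.-1)%:R * r = r1 - r.
  have : C%:R = (C.-1)%:R + 1 :> R by rewrite natr1 prednK.
  by move=> CE; rewrite -Cr CE mulrDl mul1r addrK.
pose a c := expR (- delta) * pi0 c.
exists r, (\prod_(c < C) expR (`|alpha c - 1| * ln (a c))); split => //.
  by apply: prodr_gt0 => c _; exact: expR_gt0.
move=> y yr.
have ya c : (c < C)%N -> a c <= simplex_ext R C y c.
  move=> cC; have := r1pi c cC; rewrite /a => h1.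
  have rr1 : r <= r1.
    by rewrite -Cr ler_peMl ?(ltW r0)// ler1n.
  rewrite /simplex_ext; case: ifPn => [cC1|cC1].
    have /andP[h2 _] := yr c cC1; lra.
  have -> : c = C.-1 by apply/eqP; rewrite eqn_leq -ltnS prednK// cC/= leqNgt.
  rewrite eqxx.
  have : \sum_(k < C.-1) y k <= \sum_(k < C.-1) (pi0 k + r).
    by apply: ler_sum => k _; have /andP[_ /ltW] := yr k (ltn_ord k).
  rewrite big_split/= sumr_const card_ord -mulr_natl C1r.
  have : \sum_(k < C.-1) pi0 k + pi0 C.-1 = 1.
    by rewrite -pi01; move: C0; case: (C) => // C' _; rewrite big_ord_recr.
  have := r1pi C.-1; rewrite prednK// leqnn => /(_ isT).
  move: (\sum_(k < C.-1) pi0 k) (\sum_(k < C.-1) y k) => x1 x2 h2 h3 h4; lra.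
have a0 c : (c < C)%N -> 0 < a c by move=> cC; rewrite mulr_gt0 ?expR_gt0 ?pi00.
have y0 c : (c < C)%N -> 0 < simplex_ext R C y c.
  by move=> cC; rewrite (lt_le_trans (a0 c cC)) ?ya.
split.
  move=> c cC; have := ya c cC; rewrite /a expRN mulrC ler_pdivrMr ?expR_gt0//.
  by rewrite mulrC.
rewrite /undensDir; case: ifPn => [_|/asboolP//].
apply: ler_prod => c _; rewrite expR_ge0/=.
have cC := ltn_ord c.
have y1 : simplex_ext R C y c <= 1.
  rewrite -(simplex_ext_sum y) (bigD1 c)//= lerDl.
  by apply: sumr_ge0 => i _; rewrite ltW ?y0.
rewrite /powR gt_eqF ?y0// ler_expR.
have l1 : ln (simplex_ext R C y c) <= 0 by rewrite ln_le0.
have l2 : ln (a c) <= ln (simplex_ext R C y c) by rewrite ler_ln ?posrE ?ya ?y0 ?a0.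
(* The exponent may have either sign. For a nonnegative one, monotonicity of the logarithm suffices;
   for a negative one, the power is at least 1 because the weight is at most 1, while the lower
   bound is at most 1. *)
have [h|h] := leP 0 (alpha c - 1).
  by rewrite ger0_norm// ler_wpM2l.
rewrite ltr0_norm//; nra.
Qed.

End Dirichlet.

(** * Assembling the prior *)

Section Prior.
Variables (R : realType) (n p C : nat).
Hypothesis hpn : (p <= n)%N.
Hypothesis C0 : (0 < C)%N.
Variables (mun : probability (mxB R n p) R) (mup : probability (mxB R p p) R).
Hypothesis hmun : is_haar_stiefel R n p mun.
Hypothesis hmup : is_haar_stiefel R p p mup.
Variables (G : nat -> 'M[R]_(n, p)) (H : nat -> 'M[R]_p) (nu : nat -> R)
  (eta : nat -> nat -> R) (alpha : nat -> R).
Hypothesis hnu : forall c, (c < C)%N -> 0 < nu c.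

Let Jpi (F : (nat -> R) -> \bar R) : \bar R :=
  lebdensI C.-1 (undensDir R C alpha) (F \o simplex_ext R C).
(** The pairs are nested in the order of the integrals of [priorInt], so that [priorInt] is by
    conversion an iterated [bind] transported along [to_param]. *)
Let to_param (q : (nat -> 'M[R]_(n, p)) * ((nat -> nat -> R) * ((nat -> 'M[R]_p) * (nat -> R)))) :=
  Param R n p q.1 q.2.1 q.2.2.1 q.2.2.2.

Let sub_tilde : StiefelTilde R n p `<=` Stiefel R n p.
Proof. by move=> X []. Qed.

Let simplex (w : nat -> R) := (forall c, (c < C)%N -> 0 < w c) /\ \sum_(c < C) w c = 1.

Definition param_coord (i : nat * ('I_n * 'I_p) + (nat * nat + (nat * ('I_p * 'I_p) + nat)))
    (th : param R n p) : R :=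
  match i with
  | inl (c, (k, l)) => pM th c k l
  | inr (inl (c, j)) => pd th c j
  | inr (inr (inl (c, (k, l)))) => pV th c k l
  | inr (inr (inr c)) => ppi th c
  end.

Let Jpi_repr : repr (fun c (w : nat -> R) => w c) simplex Jpi.
Proof.
apply: (push_repr (m := simplex_ext R C) (lebdensI_repr C.-1 (P := fun w =>
    forall c, (c < C)%N -> 0 < simplex_ext R C w c) _ _ _)).
- exact: undensDir_ge0.
- exact: undensDir_supp.
- exact: measurable_undensDir.
- by move=> d S f mf c; exact: measurable_simplex_ext.
- by move=> w hw; split => //; exact: simplex_ext_sum.
Qed.

Lemma prior_repr :
  repr param_coord (inXi R n p C) (priorInt R n p C mun mup G H nu eta alpha).
Proof.
have RM := iterI_repr C (fun=> 0) (fun c => langevinI_repr mun (G c) (@measurable_StiefelTilde R n p)).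
have Rd := iterI_repr C (fun _ _ => 0) (fun c => lebdensI_repr p
  (@undensd_ge0 R n p mun (nu c) (eta c)) (@undensd_supp R n p mun (nu c) (eta c))
  (@measurable_undensd R n p mun (nu c) (eta c))).
have RV := iterI_repr C (fun=> 0) (fun c => langevinI_repr mup (H c) (@measurable_Stiefel R p p)).
apply: (push_repr (m := to_param) (bind_repr RM (bind_repr Rd (bind_repr RV Jpi_repr)))).
- move=> d S f mf [[c [k l]]|[[c j]|[[c [k l]]|c]]].
  + exact: (mf (inl (c, (k, l)))).
  + exact: (mf (inr (inl (c, j)))).
  + exact: (mf (inr (inr (inl (c, (k, l)))))).
  + exact: (mf (inr (inr (inr c)))).
- move=> [M [v [V w]]] [/= hM [hv [hV [hw hw1]]]]; split => // c cC.
  by split; [exact: hM|split; [exact: hv|exact: hV]].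
Qed.

Lemma pfun_weaken (T : Type) (P B B' : T -> Prop) (J : (T -> \bar R) -> \bar R) :
  pfun P B J -> (forall t, P t -> B t -> B' t) -> pfun P B' J.
Proof. by move=> h BB'; exact: (push_pfun (m := id) h). Qed.

Variable th0 : param R n p.
Hypothesis hth0 : inXi R n p C th0.

Let JM_pfun (rho : R) c : 0 < rho -> (c < C)%N ->
  pfun (StiefelTilde R n p) (mx_box (pM th0 c) rho) (langevinI mun (StiefelTilde R n p) (G c)).
Proof.
move=> rho0 cC; have [[HM HM0] _] := hth0.1 c cC.
(* Smallest entry of the first row of the true frame: a perturbation below it keeps the signs that
   define [StiefelTilde]. The value 1 is a placeholder for the other rows. *)
have [r r0 rM] : exists2 r, 0 < r & forall ij : 'I_n * 'I_p,
    r <= (if (ij.1 : nat) == 0%N then pM th0 c ij.1 ij.2 else 1).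
  by apply: pos_lower_bound_fin => ij; case: eqP => // /HM0.
apply: (pfun_weaken (B := mx_box (pM th0 c) (Num.min r rho))); last first.
  by move=> X _ BX i j; rewrite (lt_le_trans (BX i j))// ge_min lexx orbT.
have mST := @measurable_StiefelTilde R n p.
have m0 : 0 < Num.min r rho by rewrite lt_min r0.
apply: langevinI_pfun => // X HX BX; split=> // i j i0.
have := BX i j; have := rM (i, j); rewrite /= i0 eqxx => h1.
rewrite lt_min ltr_norml => /andP[/andP[h2 _] _]; lra.
Qed.

Let JV_pfun (rho : R) c : 0 < rho -> (c < C)%N ->
  pfun (Stiefel R p p) (mx_box (pV th0 c) rho) (langevinI mup (Stiefel R p p) (H c)).
Proof.
move=> rho0 cC; have [_ [_ HV]] := hth0.1 c cC.
have mS := @measurable_Stiefel R p p.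
exact: langevinI_pfun.
Qed.

Let Jd_pfun (rho : R) c : 0 < rho -> rho <= 1 -> (c < C)%N ->
  pfun (Sp R p) (fun y => forall j, (j < p)%N -> `|y j - pd th0 c j| <= rho)
    (lebdensI p (undensd R n p mun (nu c) (eta c))).
Proof.
move=> rho0 rho1 cC; have [_ [Hd _]] := hth0.1 c cC.
have [r [e [r0 rrho e0 He]]] := undensd_box hmun hpn (eta c) (ltW (hnu cC)) Hd rho0 rho1.
apply: (pfun_weaken (B := fun y => forall j, (j < p)%N -> pd th0 c j - r < y j < pd th0 c j + r)).
  apply: (lebdensI_pfun (@undensd_ge0 R n p mun (nu c) (eta c))
    (@undensd_supp R n p mun (nu c) (eta c)) _ e0 He) => j _.
  by lra.
move=> y _ By j jp; have /andP[h1 h2] := By j jp.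
by rewrite ler_norml; apply/andP; split; lra.
Qed.

Let Jpi_pfun (delta : R) : 0 < delta ->
  pfun simplex (fun w => forall c, (c < C)%N -> ppi th0 c <= expR delta * w c) Jpi.
Proof.
move=> delta0.
have [r [e [r0 e0 He]]] := undensDir_box alpha C0 hth0.2.1 hth0.2.2 delta0.
have ab j : (j < C.-1)%N -> ppi th0 j - r < ppi th0 j + r by move=> _; lra.
apply: (push_pfun (m := simplex_ext R C) (lebdensI_pfun (@undensDir_ge0 R C alpha)
  (@undensDir_supp R C alpha) ab e0 (fun y yr => (He y yr).2))).
- by move=> w hw; split => //; exact: simplex_ext_sum.
- by move=> w _ /He[].
Qed.

Lemma prior_pfun (delta : R) : 0 < delta ->
  pfun (inXi R n p C) (param_close C mun th0 delta)
    (priorInt R n p C mun mup G H nu eta alpha).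
Proof.
move=> delta0.
pose D := \sum_(c < C) \sum_(k < p) `|pd th0 c k|.
have D0 : 0 <= D by apply: sumr_ge0 => c _; exact: sumr_ge0.
have d0D c k : (c < C)%N -> (k < p)%N -> `|pd th0 c k| <= D.
  move=> cC kp; rewrite /D (bigD1 (Ordinal cC))//= (bigD1 (Ordinal kp))//= -addrA lerDl.
  by rewrite addr_ge0//; apply: sumr_ge0 => // ? _; exact: sumr_ge0.
pose L := lipschitz_cst n p D; have L0 : 0 <= L by exact: lipschitz_cst_ge0.
(* Chosen so that 2 L rho <= delta / 2; the summand 4 keeps the denominator positive when [L] is
   0. *)
pose rho := Num.min 1 (delta / (4 * L + 4)).
have L4 : 0 < 4 * L + 4 by lra.
have rho0 : 0 < rho by rewrite lt_min ltr01 divr_gt0.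
have rho1 : rho <= 1 by rewrite ge_min lexx.
have Lrho : 2 * (L * rho) <= delta / 2.
  have : rho <= delta / (4 * L + 4) by rewrite ge_min lexx orbT.
  rewrite ler_pdivlMr// => h; nra.
have PM := iterI_pfun (fun=> 0) (fun c cC => JM_pfun rho0 cC).
have Pd := iterI_pfun (fun _ _ => 0) (fun c cC => Jd_pfun rho0 rho1 cC).
have PV := iterI_pfun (fun=> 0) (fun c cC => JV_pfun rho0 cC).
have delta20 : 0 < delta / 2 by rewrite divr_gt0.
have inXiP (q : (nat -> 'M[R]_(n, p)) * ((nat -> nat -> R) * ((nat -> 'M[R]_p) * (nat -> R)))) :
    (forall c, (c < C)%N -> StiefelTilde R n p (q.1 c)) /\
    (forall c, (c < C)%N -> Sp R p (q.2.1 c)) /\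
    (forall c, (c < C)%N -> Stiefel R p p (q.2.2.1 c)) /\ simplex q.2.2.2 ->
    inXi R n p C (to_param q).
  move=> [hM [hv [hV [hw hw1]]]]; split => // c cC.
  by split; [exact: hM|split; [exact: hv|exact: hV]].
apply: (push_pfun (m := to_param) (bind_pfun PM (bind_pfun Pd (bind_pfun PV (Jpi_pfun delta20))))).
  by move=> q; exact: inXiP.
move=> q Pq [hM [hv [hV hw]]].
apply: (fmix_close hmun hpn hth0 (inXiP _ Pq) (D := D) (r := rho)) => //; first by rewrite ltW.
move=> c cC; split => //.
- by move=> k kp; exact: d0D.
- exact: hv.
- by move=> i j; exact/ltW/hV.
- by move=> i j; exact/ltW/hM.
- exact: hw.
Qed.

Lemma prior_mass : (priorInt R n p C mun mup G H nu eta alpha (fun=> 1) <= 1)%E.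
Proof.
(* The radius 1 is arbitrary here: the mass bound draws on positivity and monotonicity alone. *)
have PM := iterI_pfun (fun=> 0) (fun c cC => JM_pfun ltr01 cC).
have Pd := iterI_pfun (fun _ _ => 0) (fun c cC => Jd_pfun ltr01 (lexx 1) cC).
have PV := iterI_pfun (fun=> 0) (fun c cC => JV_pfun ltr01 cC).
have Ppi := Jpi_pfun ltr01.
apply: (bind_mass PM (bind_pfun Pd (bind_pfun PV Ppi))).
  apply: (iterI_mass _ (fun c cC => JM_pfun ltr01 cC)) => c cC.
  by apply: langevinI_mass; [exact: measurable_StiefelTilde|exact: sub_tilde].
apply: (bind_mass Pd (bind_pfun PV Ppi)).
  apply: (iterI_mass _ (fun c cC => Jd_pfun ltr01 (lexx 1) cC)) => c cC.
  by apply: lebdensI_mass; [exact: undensd_ge0|exact: measurable_undensd].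
apply: (bind_mass PV Ppi).
  apply: (iterI_mass _ (fun c cC => JV_pfun ltr01 cC)) => c cC.
  by apply: langevinI_mass => //; exact: measurable_Stiefel.
by apply: lebdensI_mass; [exact: undensDir_ge0|exact: measurable_undensDir].
Qed.

End Prior.

(** * Posterior consistency *)

Section HalfSpaces.
Variables (R : realType) (n p C : nat).
Hypothesis hpn : (p <= n)%N.
Hypothesis C0 : (0 < C)%N.
Variables (mun : probability (mxB R n p) R) (mup : probability (mxB R p p) R).
Hypothesis hmun : is_haar_stiefel R n p mun.
Hypothesis hmup : is_haar_stiefel R p p mup.
Variables (G : nat -> 'M[R]_(n, p)) (H : nat -> 'M[R]_p) (nu : nat -> R)
  (eta : nat -> nat -> R) (alpha : nat -> R).
Hypothesis hnu : forall c, (c < C)%N -> 0 < nu c.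
Variable th0 : param R n p.
Hypothesis hth0 : inXi R n p C th0.
Variables (dO : measure_display) (Omega : measurableType dO) (P : probability Omega R)
  (X : nat -> Omega -> mxB R n p).
Hypothesis hXmeas : forall i, measurable_fun setT (X i).
Hypothesis hXind : mutually_independent R dO Omega n p P X.
Hypothesis hXlaw : forall i (A : set (mxB R n p)), measurable A ->
  P (X i @^-1` A) = (\int[mun]_(x in A) (fmix R n p C mun th0 x)%:E)%E.

Local Notation St := (Stiefel R n p : set (mxB R n p)).
Local Notation f th := (fmix R n p C mun th).

Variables (I : finType) (g : I -> mxB R n p -> R) (B0 eps : R).
Hypothesis mg : forall i, measurable_fun setT (g i).
Hypothesis gB : forall i x, St x -> `|g i x| <= B0.
Hypothesis eps0 : 0 < eps.

Let mean i th := Rintegral mun St (fun x => g i x * f th x).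
Definition half_space i th := mean i th0 + eps <= mean i th.

Let a i := mean i th0 + eps / 2.
Let u i x := g i x - a i.
(** One bound and one [l] for all indices, so that every half-space has the same rate [rho]. The
    summand 1 keeps [B] positive, and the two terms of [l] are the two smallness conditions of
    [tilted_mass_le]. *)
Let B := \sum_i `|a i| + `|B0| + 1.
Let l := Num.min (2^-1 / B) (eps / 2 / (4 * B ^+ 2)).
Let e := eps / 2.

Let B_gt0 : 0 < B.
Proof. by rewrite ltr_wpDl// addr_ge0//; exact: sumr_ge0. Qed.

Let e_gt0 : 0 < e. Proof. by rewrite divr_gt0. Qed.

Let l_gt0 : 0 < l.
Proof. by rewrite lt_min !divr_gt0 ?invr_gt0 ?mulr_gt0// exprn_gt0. Qed.

Let lB : l * B <= 2^-1.
Proof. by rewrite -ler_pdivlMr// ge_min lexx. Qed.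

Let lBe : 4 * l * B ^+ 2 <= e.
Proof.
have B2 : 0 < 4 * B ^+ 2 by rewrite mulr_gt0// exprn_gt0.
have : l <= e / (4 * B ^+ 2) by rewrite ge_min lexx orbT.
by rewrite ler_pdivlMr//; apply: le_trans; rewrite le_eqVlt; apply/orP; left; apply/eqP; ring.
Qed.

Let uB i x : St x -> `|u i x| <= B.
Proof.
move=> Sx; rewrite /u /B (le_trans (ler_normB _ _))// addrC -addrA lerD//.
  by rewrite (bigD1 i)//= lerDl; exact: sumr_ge0.
by rewrite (le_trans (gB i Sx))// (le_trans (ler_norm _))// lerDl.
Qed.

Let u_meas i : measurable_fun setT (u i).
Proof. by apply: measurable_funB => //; exact: mg. Qed.

Let mSt : measurable St. Proof. exact: measurable_Stiefel. Qed.

Let mf th : measurable_fun setT (f th : mxB R n p -> R).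
Proof. exact: measurable_fmix1. Qed.

Let mean_u i th : inXi R n p C th ->
  Rintegral mun St (fun x => u i x * f th x) = mean i th - a i.
Proof.
move=> hth; have [K hK] := fmix_bounded hmun hth.
have fi : mun.-integrable St (EFin \o f th).
  apply: (Stiefel_integrable mun (B := K)) => [|x Sx]; first exact: measurable_funTS.
  by case/andP: (hK x Sx) => h0 hK'; rewrite ger0_norm.
have gfi : mun.-integrable St (EFin \o (fun x => g i x * f th x)).
  apply: (Stiefel_integrable mun (B := B0 * K)) => [|x Sx].
    by apply: measurable_funTS; apply: measurable_funM => //; exact: mf.
  by case/andP: (hK x Sx) => h0 hK'; rewrite normrM (ger0_norm h0) ler_pM// gB.
have afi : mun.-integrable St (EFin \o (fun x => a i * f th x)).
  exact: (integrableZl mSt (a i) fi).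
transitivity (Rintegral mun St (fun x => g i x * f th x - a i * f th x)).
  by apply: eq_Rintegral => x _; rewrite mulrBl.
by rewrite RintegralB// RintegralZl// (fmix_Rintegral hmun hpn hth) mulr1.
Qed.

Let rho := expR (- (l * e / 2)).

Let indic_integral (h : mxB R n p -> R) (K : R) : measurable_fun setT h ->
  (forall x, St x -> `|h x| <= K) ->
  (\int[mun]_x (\1_St x * h x)%:E = (Rintegral mun St h)%:E)%E.
Proof.
move=> mh hK.
have hi : mun.-integrable St (EFin \o h).
  by apply: (Stiefel_integrable mun (B := K)) => //; exact: measurable_funTS.
rewrite /Rintegral fineK; last exact: (integrable_fin_num mSt hi).
rewrite [RHS]integral_mkcond; apply: eq_integral => x _.
by rewrite patchE indicE; case: ifPn => _; rewrite ?mul1r ?mul0r.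
Qed.

Let tilted_bound th (v : mxB R n p -> R) : inXi R n p C th -> measurable_fun setT v ->
  (forall x, St x -> `|v x| <= B) -> e <= Rintegral mun St (fun x => v x * f th x) ->
  (\int[mun]_x (\1_St x * (f th x * expR (- (l * v x))))%:E <= rho%:E)%E.
Proof.
move=> hth mv vB ev; have [K hK] := fmix_bounded hmun hth.
rewrite (indic_integral (K := K * expR 2^-1)).
- rewrite lee_fin; apply: (tilted_mass_le (K := K) (B := B)) => //.
  + exact: measurable_funTS.
  + exact: measurable_funTS.
  + exact: (fmix_Rintegral hmun hpn hth).
- apply: measurable_funM; first exact: mf.
  by apply: measurableT_comp => //; apply: measurableT_comp => //; exact: measurable_funM.
- move=> x Sx; case/andP: (hK x Sx) => h0 hK'.
  rewrite normrM (ger0_norm h0) (ger0_norm (expR_ge0 _)) ler_pM// ler_expR.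
  rewrite (le_trans (ler_norm _))// normrN normrM gtr0_norm// (le_trans _ lB)//.
  by rewrite ler_pM2l// vB.
Qed.

(** On the manifold q times q' is the likelihood ratio of one observation: the weight is put in [q]
    and its inverse in [q']. The indicator confines both to where [u] is bounded. *)
Let q i th x := \1_St x * (f th x / f th0 x * expR (- (l * u i x))).
Let q' i x := \1_St x * expR (l * u i x).

Let f_gt0 th x : inXi R n p C th -> 0 < f th x.
Proof. by move=> hth; exact: fmix_gt0. Qed.

Let mq' i : measurable_fun setT (q' i).
Proof.
apply: measurable_funM; first exact: measurable_indic.
by apply: measurableT_comp => //; apply: measurable_funM => //; exact: u_meas.
Qed.

Let iid_le (h : mxB R n p -> R) (r : R) N : (forall x, 0 <= h x) -> measurable_fun setT h ->
  (\int[mun]_x (h x * f th0 x)%:E <= r%:E)%E ->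
  (\int[P]_w (\prod_(j < N) h (X j w))%:E <= (r ^+ N)%:E)%E.
Proof.
move=> h0 mh hr; apply: (iid_prod_integral_le hXmeas hXind _ (mf th0) hXlaw) => // x.
exact/ltW/f_gt0.
Qed.

(** The tilt is by -u, whose mean under the true density is exactly [e], by the centring halfway. *)
Let q'_prod_le i N : (\int[P]_w (\prod_(j < N) q' i (X j w))%:E <= (rho ^+ N)%:E)%E.
Proof.
apply: iid_le => //; first by move=> x; rewrite mulr_ge0 ?expR_ge0.
have := @tilted_bound th0 (fun x => - u i x) hth0.
under eq_integral do rewrite mulrN opprK (mulrC (f th0 _)) mulrA.
apply.
- exact: measurableT_comp.
- by move=> x Sx; rewrite normrN uB.
- have -> : Rintegral mun St (fun x => - u i x * f th0 x) =
      Rintegral mun St (fun x => -1 * (u i x * f th0 x)).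
    by apply: eq_Rintegral => x _; rewrite mulN1r mulNr.
  have [K hK] := fmix_bounded hmun hth0.
  rewrite RintegralZl//.
    by rewrite mean_u// /a /e mulN1r; lra.
  apply: (Stiefel_integrable mun (B := B * K)) => [|x Sx].
    by apply: measurable_funTS; apply: measurable_funM.
  by case/andP: (hK x Sx) => h0 hK'; rewrite normrM (ger0_norm h0) ler_pM// uB.
Qed.

(** The true density cancels against the denominator of the ratio, leaving the mass of the density
    at [th] tilted by [u], whose mean is at least [e] on the half-space. *)
Let q_prod_le i th N : inXi R n p C th -> half_space i th ->
  (\int[P]_w (\prod_(j < N) q i th (X j w))%:E <= (rho ^+ N)%:E)%E.
Proof.
move=> hth hi; apply: iid_le.
- by move=> x; rewrite !mulr_ge0 ?expR_ge0 ?invr_ge0// ltW ?f_gt0.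
- apply: measurable_funM; first exact: measurable_indic.
  apply: measurable_funM.
    apply: measurable_funM; first exact: mf.
    by apply: measurable_invr_ge0; [move=> x; exact/ltW/f_gt0|exact: mf].
  apply: measurableT_comp => //; apply: measurableT_comp => //.
  by apply: measurable_funM => //; exact: u_meas.
- have ev : e <= Rintegral mun St (fun x => u i x * f th x).
    rewrite mean_u// /a /e; move: hi; rewrite /half_space.
    by move: (mean i th) (mean i th0) => y y0 h; lra.
  apply: le_trans (tilted_bound hth (u_meas i) (@uB i) ev).
  rewrite le_eqVlt; apply/orP; left; apply/eqP; apply: eq_integral => x _.
  have cancel (b y y0 z : R) : y0 != 0 -> b * (y / y0 * z) * y0 = b * (y * z).
    by move=> ?; field.
  by rewrite /q cancel// gt_eqF ?f_gt0.
Qed.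

Lemma half_spaces_posterior (U : set (param R n p)) :
  (forall th, inXi R n p C th -> ~ U th -> exists i, half_space i th) ->
  \forall w \ae P, (fun N => posterior R n p C mun mup G H nu eta alpha th0 (~` U)
    (fun i => X i w) N) @ \oo --> (0 : R).
Proof.
move=> hU; pose prior := priorInt R n p C mun mup G H nu eta alpha.
(* The numerator falls below exp(- l e / 4)^N and the denominator stays above a multiple of exp(- l
   e / 8)^N, so the quotient still decays like exp(- l e / 8)^N. *)
pose delta := l * e / 8.
have le0 : 0 < l * e by rewrite mulr_gt0.
have delta0 : 0 < delta by rewrite divr_gt0.
have PF : pfun (inXi R n p C) (param_close C mun th0 delta) prior.
  exact: prior_pfun.
(* For a null functional the posterior is 0 / 0, which is 0 by convention. *)
have [nullp|[m0 m0_gt0 lbp]] := pfun_lb PF.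
  apply: aeW => w; rewrite (_ : (fun N => _) = (fun=> 0)); first exact: cvg_cst.
  by apply/funext => N; rewrite /posterior -/prior !nullp mul0r.
have RP : repr (@param_coord R n p) (inXi R n p C) prior by exact: prior_repr.
have [dS S m phi wt mphi mwt wt0 wtP RE] := RP.
have mth : param_measurable phi.
  split.
  - by move=> c k j; exact: (mphi (inl (c, (k, j)))).
  - by move=> c j; exact: (mphi (inr (inl (c, j)))).
  - by move=> c k j; exact: (mphi (inr (inr (inl (c, (k, j)))))).
  - by move=> c; exact: (mphi (inr (inr (inr c)))).
pose A i : set (param R n p) := half_space i.
have mA i : measurable_fun setT (fun s => \1_(A i) (phi s) : R).
  rewrite (_ : (fun _ => _) = \1_(phi @^-1` A i)); last first.
    apply/funext => s; have [As|nAs] := pselect (A i (phi s)).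
      by rewrite !indicE !mem_set.
    by rewrite !indicE !memNset.
  apply: measurable_indic.
  rewrite (_ : phi @^-1` A i = setT `&`
      (fun s => mean i th0 + eps <= mean i (phi s)) @^-1` [set true]); last by rewrite setTI.
  apply: measurable_fun_ler => //.
  apply: measurable_Rintegral_param => //; apply: measurable_funM.
    exact: (measurableT_comp (mg i)).
  apply: measurable_fmix => //; first exact: param_measurable_comp.
  by move=> k j; exact: (measurableT_comp (measurable_mx_entry k j)).
pose Q i N (w : Omega) s := \prod_(j < N) q i (phi s) (X j w).
have mQ i N : measurable_fun setT (fun ws : Omega * S => Q i N ws.1 ws.2).
  apply: measurable_prod => j _.
  have mXj : measurable_fun setT (fun ws : Omega * S => X j ws.1).
    exact: (measurableT_comp (hXmeas j)).
  apply: measurable_funM.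
    by apply: (measurableT_comp (f := \1_St : mxB R n p -> R)) => //; exact: measurable_indic.
  apply: measurable_funM; last first.
    apply: measurableT_comp => //; apply: measurableT_comp => //; apply: measurable_funM => //.
    exact: (measurableT_comp (u_meas i)).
  apply: measurable_funM; last first.
    apply: measurable_invr_ge0; first by move=> ws; exact/ltW/f_gt0.
    exact: (measurableT_comp (mf th0)).
  apply: measurable_fmix => //; first exact: param_measurable_comp.
  by move=> k l'; exact: (measurableT_comp (measurable_mx_entry k l')).
(* Where [wt] vanishes the parameter may lie outside Xi and the mixture may be negative; the
   absolute value gives Tonelli a function that is nonnegative everywhere. *)
pose F i N w s := \1_(A i) (phi s) * `|Q i N w s| * wt s.
have F0 i N w s : 0 <= F i N w s by rewrite !mulr_ge0.
have mF i N : measurable_fun setT (fun ws : Omega * S => (F i N ws.1 ws.2)%:E).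
  apply/measurable_EFinP; apply: measurable_funM; last exact: (measurableT_comp mwt).
  apply: measurable_funM; first exact: (measurableT_comp (mA i)).
  by apply: measurableT_comp => //; exact: mQ.
have mF2 i N : measurable_fun setT (fun w => \int[m]_s (F i N w s)%:E)%E.
  apply: (measurable_fun_fubini_tonelli_F _ (mF i N)) => ws.
  by rewrite lee_fin.
have wt1 : (\int[m]_s (wt s)%:E <= 1)%E.
  have := @prior_mass R n p C hpn C0 mun mup hmun hmup G H nu eta alpha hnu th0 hth0.
  rewrite -/prior RE//.
  by under eq_integral do rewrite mul1e.
have q'0 i x : 0 <= q' i x by rewrite mulr_ge0 ?expR_ge0.
have FE i N : (\int[P]_w \int[m]_s (F i N w s)%:E <= (rho ^+ N)%:E)%E.
  have F0' (ws : Omega * S) : (0 <= (F i N ws.1 ws.2)%:E)%E by rewrite lee_fin.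
  rewrite (fubini_tonelli (fun ws : Omega * S => (F i N ws.1 ws.2)%:E) (mF i N) F0').
  apply: (@le_trans _ _ (\int[m]_s ((rho ^+ N)%:E * (wt s)%:E))%E); last first.
    have rN0 : 0 <= rho ^+ N by rewrite exprn_ge0 ?expR_ge0.
    rewrite ge0_integralZl_EFin//; first last.
    - exact/measurable_EFinP.
    - by move=> s _; rewrite lee_fin.
    by rewrite -[leRHS]mule1 lee_wpmul2l// lee_fin.
  apply: le_integral_nonneg => s _ /=; first by apply: integral_ge0 => w _; rewrite lee_fin.
  have [ws0|/wtP hth] := eqVneq (wt s) 0.
    rewrite ws0 mule0 integral0_eq// => w _; by rewrite /F ws0 mulr0.
  have [hi|nhi] := pselect (half_space i (phi s)); last first.
    rewrite integral0_eq; last first.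
      by move=> w _; rewrite /F indicE memNset// !mul0r.
    by rewrite -EFinM lee_fin mulr_ge0 ?exprn_ge0 ?expR_ge0.
  have q0 x : 0 <= q i (phi s) x.
    by rewrite !mulr_ge0 ?expR_ge0 ?invr_ge0// ltW ?f_gt0.
  have -> : (\int[P]_w (F i N w s)%:E = \int[P]_w ((wt s)%:E * (Q i N w s)%:E))%E.
    apply: eq_integral => w _; rewrite /F indicE mem_set// mul1r mulrC EFinM.
    by rewrite ger0_norm//; apply: prodr_ge0.
  have mQs : measurable_fun setT (fun w => (Q i N w s)%:E).
    by apply/measurable_EFinP; exact: (measurableT_comp (mQ i N) (pair2_measurable s)).
  rewrite ge0_integralZl_EFin//; first by rewrite muleC lee_wpmul2r ?lee_fin// q_prod_le.
  by move=> w _; rewrite lee_fin; apply: prodr_ge0.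
(* One sequence carries both the weighted likelihoods and the products of inverse weights, so a
   single use of Borel-Cantelli controls them all. *)
pose Y N w := (\sum_i (\int[m]_s (F i N w s)%:E + (\prod_(j < N) q' i (X j w))%:E))%E.
have intF0 i N w : (0 <= \int[m]_s (F i N w s)%:E)%E.
  by apply: integral_ge0 => s _; rewrite lee_fin.
have prodq'0 i N w : (0 <= (\prod_(j < N) q' i (X j w))%:E)%E.
  by rewrite lee_fin; apply: prodr_ge0.
have mprodq' i N : measurable_fun setT (fun w => (\prod_(j < N) q' i (X j w))%:E).
  apply/measurable_EFinP; apply: measurable_prod => j _.
  exact: (measurableT_comp (mq' i) (hXmeas j)).
have Y0 N w : (0 <= Y N w)%E by apply: sume_ge0 => i _; exact: adde_ge0.
have mY N : measurable_fun setT (Y N).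
  by apply: emeasurable_sum => i; exact: emeasurable_funD.
have EY N : (\int[P]_w Y N w <= ((#|I| * 2)%:R * rho ^+ N)%:E)%E.
  rewrite /Y ge0_integral_sum//; first last.
  - by move=> i w _; exact: adde_ge0.
  - by move=> i; exact: emeasurable_funD.
  apply: (@le_trans _ _ (\sum_(i in I) (rho ^+ N *+ 2)%:E)%E).
    apply: lee_sum => i _; rewrite ge0_integralD// mulr2n EFinD.
    by apply: leeD; [exact: FE|exact: q'_prod_le].
  by rewrite sumEFin sumr_const -mulrnA mulr_natl mulnC.
pose sigma := expR (- (l * e / 4)).
have rs : 0 < rho < sigma by rewrite expR_gt0 ltr_expR; lra.
have aeY := ae_eventually_lt (ler0n R (#|I| * 2)) rs mY Y0 EY.
have aeSt : \forall w \ae P, forall j, St (X j w).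
  apply: ae_foralln => j; exists (X j @^-1` (~` St)); split.
  - by rewrite -[X in measurable X]setTI; apply: hXmeas => //; exact: measurableC.
  - transitivity (\int[mun]_(x in ~` St) (f th0 x)%:E)%E.
      by apply: hXlaw; exact: measurableC.
    apply: null_set_integral; first exact: measurableC.
      by apply/measurable_EFinP; apply: measurable_funTS; exact: mf.
    exact: haar_setCStiefel.
  - by move=> w /=.
apply: filterS2 aeSt aeY => w hSt hY.
pose z := expR (- delta).
have z01 : `|z| < 1 by rewrite ger0_norm ?expR_ge0// -expR0 ltr_expR; lra.
apply: (@squeeze_cvgr _ _ _ _ (fun=> 0) (fun N => geometric (m0^-1) z N)); last 2 first.
- exact: cvg_cst.
- exact: cvg_geometric.
apply: filterS hY => N YN.
pose x j := X j w.
have numle : (prior (fun th => (if `[< (~` U) th >] then RN R n p C mun th0 th x N else 0)%:E)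
    <= Y N w)%E.
  (* A coordinate-measurable majorant of the possibly non-measurable integrand: monotonicity of the
     prior leads to [Psi], to which the integral representation applies. *)
  pose Psi th : \bar R := (\sum_i \1_(A i) th * `|\prod_(j < N) q i th (x j)|)%:E.
  (* Each product of [q'] is a term of [Y], hence below 1. Dividing the likelihood ratio by it only
     enlarges it, so the ratio is at most the product of the [q]. *)
  have q'1 i : \prod_(j < N) q' i (x j) < 1.
    have s1 : sigma ^+ N <= 1 by rewrite exprn_ile1 ?expR_ge0// -expR0 ler_expR; lra.
    rewrite -lte_fin; apply: (@lt_le_trans _ _ (sigma ^+ N)%:E); last by rewrite lee_fin.
    apply: le_lt_trans YN; rewrite /Y (bigD1 i)//=.
    apply: (@le_trans _ _ (\int[m]_s (F i N w s)%:E + (\prod_(j < N) q' i (X j w))%:E)%E).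
      exact: leeDr.
    by apply: leeDl; apply: sume_ge0 => k _; apply: (adde_ge0 (intF0 k N w) (prodq'0 k N w)).
  apply: (@le_trans _ _ (prior Psi)).
    apply: (pfun_le PF) => th hth.
      by case: ifPn => _; rewrite lee_fin ?(RN_ge0 hmun hth0).
    case: ifPn => [/asboolP nU|_]; last first.
      by rewrite lee_fin; apply: sumr_ge0 => i _; rewrite mulr_ge0.
    have [i hi] := hU th hth nU.
    rewrite lee_fin (bigD1 i)//= indicE mem_set// mul1r.
    apply: (@le_trans _ _ `|\prod_(j < N) q i th (x j)|); last first.
      by rewrite lerDl; apply: sumr_ge0 => k _; rewrite mulr_ge0.
    apply: (le_trans _ (ler_norm _)).
    have -> : \prod_(j < N) q i th (x j) =
        RN R n p C mun th0 th x N * (\prod_(j < N) q' i (x j))^-1.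
      rewrite -prodfV -big_split/=; apply: eq_bigr => j _.
      rewrite /q /q' indicE mem_set ?mul1r; last exact: hSt.
      by rewrite expRN.
    rewrite ler_peMr ?(RN_ge0 hmun hth0)// invf_ge1 ?ltW//.
    apply: prodr_gt0 => j _; rewrite mulr_gt0 ?expR_gt0// indicE mem_set//; exact: hSt.
  have PsiF s : (Psi (phi s) * (wt s)%:E = \sum_i (F i N w s)%:E)%E.
    by rewrite /Psi -EFinM mulr_suml -sumEFin.
  have mFw i : measurable_fun setT (fun s => (F i N w s)%:E).
    exact: (measurableT_comp (mF i N) (pair1_measurable w)).
  rewrite RE; first last.
  - apply/measurable_EFinP; apply: measurable_sum => i; apply: measurable_funM => //.
    apply: measurableT_comp => //.
    exact: (measurableT_comp (mQ i N) (pair1_measurable w)).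
  - by move=> s; rewrite lee_fin; apply: sumr_ge0 => i _; rewrite mulr_ge0.
  under eq_integral do rewrite PsiF.
  rewrite ge0_integral_sum//; last by move=> i s _; rewrite lee_fin.
  by apply: lee_sum => i _; exact: leeDl.
have denge : ((expR (- delta) ^+ N * m0)%:E <=
    prior (fun th => (RN R n p C mun th0 th x N)%:E))%E.
  apply: lbp; first by rewrite exprn_ge0 ?expR_ge0.
    by move=> th hth; rewrite lee_fin (RN_ge0 hmun hth0).
  by move=> th hth hc; rewrite lee_fin (RN_ge hmun hth0).
have num0 : (0 <= prior (fun th => (if `[< (~` U) th >] then RN R n p C mun th0 th x N
    else 0)%:E))%E.
  apply: (pfun_ge0 PF) => th hth.
  by case: ifPn => _; rewrite lee_fin ?(RN_ge0 hmun hth0).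
have {numle} := le_lt_trans numle YN.
rewrite /posterior -/prior -/x; move: num0 denge.
case: (prior _) => // num; rewrite lee_fin => num0.
have zN : 0 < z ^+ N by rewrite exprn_gt0 ?expR_gt0.
have gz : 0 <= geometric m0^-1 z N by rewrite /geometric/= mulr_ge0 ?invr_ge0// ltW.
(* An infinite denominator becomes 0 under [fine], and the quotient is 0. *)
case: (prior _) => [den|_|//]; last first.
  by rewrite /= invr0 mulr0 lexx.
rewrite lee_fin lte_fin => hden hnum /=.
have zm : 0 < z ^+ N * m0 by rewrite mulr_gt0.
have den0 : 0 < den by apply: lt_le_trans hden.
apply/andP; split; first by rewrite divr_ge0// ltW.
rewrite ler_pdivrMr// (le_trans (ltW hnum))//.
have -> : sigma ^+ N = geometric m0^-1 z N * (z ^+ N * m0).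
  rewrite /geometric/= [z ^+ N * m0]mulrC mulrACA mulVf ?gt_eqF// mul1r -exprMn.
  by congr (_ ^+ _); rewrite /z -expRD; congr expR; rewrite /delta; lra.
by rewrite ler_wpM2l.
Qed.

End HalfSpaces.

Theorem theorem5 (R : realType) (n p C : nat)
    (hpn : (p <= n)%N) (hC : (0 < C)%N)
    (* [dX] on V_{n,p} and the Haar measure on V_{p,p} *)
    (mun : probability (mxB R n p) R) (hmun : is_haar_stiefel R n p mun)
    (mup : probability (mxB R p p) R) (hmup : is_haar_stiefel R p p mup)
    (* hyperparameters of the prior *)
    (G : nat -> 'M[R]_(n, p)) (H : nat -> 'M[R]_p) (nu : nat -> R)
    (eta : nat -> nat -> R) (alpha : nat -> R)
    (hnu : forall c, (c < C)%N -> 0 < nu c)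
    (heta : forall c, (c < C)%N -> forall j, (j < p)%N -> eta c j < 1)
    (halpha : forall c, (c < C)%N -> 0 < alpha c)
    (* true parameter *)
    (th0 : param R n p) (hth0 : inXi R n p C th0)
    (* i.i.d. observations X_0, X_1, ... with density f(.; th0) w.r.t. [dX] *)
    (dO : measure_display) (Omega : measurableType dO) (P : probability Omega R)
    (X : nat -> Omega -> mxB R n p)
    (hXmeas : forall i, measurable_fun setT (X i))
    (hXind : mutually_independent R dO Omega n p P X)
    (hXlaw : forall i (A : set (mxB R n p)), measurable A ->
       P (X i @^-1` A) = (\int[mun]_(x in A) (fmix R n p C mun th0 x)%:E)%E)
    (U : set (param R n p)) (hU : weak_nbhd R n p C mun th0 U) :
  \forall w \ae P,
    (fun N => posterior R n p C mun mup G H nu eta alpha th0 (~` U) (fun i => X i w) N)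
      @ \oo --> (0 : R).
Proof.
have [eps [k [gg [eps0 [hgg hUsub]]]]] := hU.
pose St := (Stiefel R n p : set (mxB R n p)).
(* Both signs of each test function are taken, so that an absolute deviation of at least [eps] falls
   in one of two half-spaces. The indicator extends [gg], controlled only on the manifold, to a
   measurable function on all matrices. *)
pose g (ib : 'I_k * bool) (x : mxB R n p) : R := (-1) ^+ ib.2 * (\1_St x * gg ib.1 x).
have /choice[Bf HBf] : forall i : 'I_k, exists B : R, forall x, St x -> `|gg i x| <= B.
  by move=> i; have [[B hB] _] := hgg i (ltn_ord i); exists B.
pose B0 := \sum_i `|Bf i|.
have mg ib : measurable_fun setT (g ib).
  apply: measurable_funM => //.
  have mgSt := measurable_within_Stiefel (hgg ib.1 (ltn_ord ib.1)).2.
  rewrite (_ : (fun _ => _) = gg ib.1 \_ St).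
    by apply/(measurable_restrictT _ (@measurable_Stiefel R n p)).
  by apply/funext => x; rewrite patchE indicE; case: ifPn => _; rewrite ?mul1r ?mul0r.
have gE ib x : St x -> g ib x = (-1) ^+ ib.2 * gg ib.1 x.
  by move=> Sx; rewrite /g indicE mem_set// mul1r.
have ggB (i : 'I_k) x : St x -> `|gg i x| <= B0.
  move=> Sx; rewrite (le_trans (HBf i x Sx))// (le_trans (ler_norm _))//.
  by rewrite /B0 (bigD1 i)//= lerDl; exact: sumr_ge0.
have gB ib x : St x -> `|g ib x| <= B0.
  by move=> Sx; rewrite gE// normrM normrX normrN1 expr1n mul1r ggB.
have mean_g ib th : inXi R n p C th ->
    Rintegral mun St (fun x => g ib x * fmix R n p C mun th x) =
    (-1) ^+ ib.2 * Rintegral mun St (fun x => gg ib.1 x * fmix R n p C mun th x).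
  move=> hth; have [K hK] := fmix_bounded hmun hth.
  rewrite -RintegralZl; last 2 first.
  - exact: measurable_Stiefel.
  - apply: (Stiefel_integrable mun (B := B0 * K)) => [|x Sx].
      apply: measurable_funM.
        exact: measurable_within_Stiefel (hgg ib.1 (ltn_ord ib.1)).2.
      by apply: measurable_funTS; exact: measurable_fmix1.
    by case/andP: (hK x Sx) => h0 hK'; rewrite normrM (ger0_norm h0) ler_pM// ggB.
  by apply: eq_Rintegral => x /set_mem Sx; rewrite gE// mulrA.
apply: (half_spaces_posterior hpn hC hmun hmup G H eta alpha hnu hth0 hXmeas hXind hXlaw
  mg gB eps0) => th hth nU.
apply: contrapT => nhalf; apply: nU; apply: hUsub; split => // i ik.
have nh b : ~ half_space C mun th0 g eps (Ordinal ik, b) th.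
  by move=> h; apply: nhalf; exists (Ordinal ik, b).
pose m t := Rintegral mun St (fun x => gg i x * fmix R n p C mun t x).
have m_lt (b : bool) : (-1) ^+ b * m th < (-1) ^+ b * m th0 + eps.
  rewrite ltNge; apply/negP => h; apply: (nh b).
  have E0 := mean_g (Ordinal ik, b) th0 hth0; have E1 := mean_g (Ordinal ik, b) th hth.
  have transport (x0 x y0 y : R) : x0 = y0 -> x = y -> y0 + eps <= y -> x0 + eps <= x.
    by move=> -> ->.
  exact: (transport _ _ _ _ E0 E1 h).
change (`|m th0 - m th| < eps).
move: (m th0) (m th) (m_lt true) (m_lt false) => y0 y.
rewrite /= expr0 expr1 !mulN1r !mul1r => h1 h2.
by rewrite ltr_norml; apply/andP; split; lra.
Qed.
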